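(* Let $j\colon \mathrm{Diff}_c(\mathbb{R}^2)\to\mathbb{R}$ be a smooth shape functional such that $j(\varphi)=J(u_\varphi)$ for all $\varphi\in\mathrm{Diff}_c(\mathbb{R}^2)$, where $u_\varphi:=\varphi(\Delta)$ is the image of the unit circle $\Delta=\{(x,y)\in\mathbb{R}^2 : x^2+y^2=1\}$, for some shape differentiable functional $J\colon\mathcal{D}\to\mathbb{R}$ with $\mathcal{D}\subset P(\mathbb{R}^2)$ a set of measurable subsets of $\mathbb{R}^2$ (containing all $u_\varphi$). Then for every $\varphi\in\mathrm{Diff}_c(\mathbb{R}^2)$ and any tangent curve $\gamma\colon\mathbb{R}\to\mathrm{Diff}_c(\mathbb{R}^2)$ with $\gamma(0)=\varphi$, $$dj_\varphi(\gamma)=DJ(u_\varphi)[W],$$ where $W\in\mathfrak{X}_c(\mathbb{R}^2)\subset C^\infty(\mathbb{R}^2,\mathbb{R}^2)$ is the compactly supported smooth vector field identified with $\gamma$ under $T_\varphi\mathrm{Diff}_c(\mathbb{R}^2)\cong\mathfrak{X}_c(\mathbb{R}^2)$, $dj_\varphi$ is the push-forward of $j$ at $\varphi$, and $DJ(u_\varphi)[W]$ is the shape derivative of $J$ at $u_\varphi$ in direction $W$.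
   Context: **Diffeomorphism group.** $\mathrm{Diff}_c(\mathbb{R}^2)=\{\varphi\in C^\infty(\mathbb{R}^2,\mathbb{R}^2) : \varphi^{-1}\in C^\infty(\mathbb{R}^2,\mathbb{R}^2),\ \operatorname{supp}(\varphi-\mathrm{id})\text{ compact}\}$, regarded as an infinite-dimensional smooth manifold (in the sense of convenient calculus). $\mathfrak{X}_c(\mathbb{R}^2)$ denotes the smooth vector fields on $\mathbb{R}^2$ with compact support. $P(\mathbb{R}^2)$ is the power set of $\mathbb{R}^2$. **Tangent vectors.** For a manifold $M$ with atlas $\{(U_\alpha,\phi_\alpha)\}_\alpha$ and $p\in M$, the (kinematic) tangent space $T_pM$ is the set of differentiable curves $c\colon\mathbb{R}\to M$ with $c(0)=p$, modulo the relation $c\sim\tilde c$ iff $\frac{d}{dt}|_{t=0}\phi_\alpha(c(t))=\frac{d}{dt}|_{t=0}\phi_\alpha(\tilde c(t))$ for all $\alpha$ with $p\in U_\alpha$. A tangent curve $\gamma$ with $\gamma(0)=\varphi$ is viewed as an element of $T_\varphi\mathrm{Diff}_c(\mathbb{R}^2)$, i.e. it represents its equivalence class; write $\gamma(t,x)=\gamma(t)(x)$. The identification $T_\varphi\mathrm{Diff}_c(\mathbb{R}^2)\cong\mathfrak{X}_c(\mathbb{R}^2)$ is: $\gamma\cong W$ if and only if $F_t(x):=\gamma(t,x)$ satisfies $$\frac{d}{dt}F_t(x)=W(F_t(x)),\qquad F_0(x)=\varphi(x)$$ (as an identification of tangent vectors, the representative of the class being the curve that solves this equation). **Push-forward.**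 For smooth $j\colon M\to\mathbb{R}$ and a tangent vector at $p$ represented by a curve $c$, $dj_p(c)=\frac{d}{dt}\big|_{t=0}j(c(t))$, which depends only on the equivalence class of $c$. **Shape derivative.** For a time-independent vector field $W$ on $\mathbb{R}^2$ let $F_t^W$ be the transformation given by the velocity method, i.e. $F_t^W(x)=\eta(t,x)$ where $\partial_t\eta(t,x)=W(\eta(t,x))$, $\eta(0,x)=x$, and put $F_t^W(u)=\{F_t^W(x):x\in u\}$. The Eulerian derivative of $J\colon\mathcal{D}\to\mathbb{R}$ at $u\in\mathcal{D}$ in direction $W$ is $$DJ(u)[W]=\lim_{t\searrow 0}\frac{J(F_t^W(u))-J(u)}{t}.$$ The admissible directions $W$ form a space $\mathcal{H}$ ($W^{1,\infty}$ or $C_0^k$ vector fields with $k\in\mathbb{N}\cup\{\infty\}$, such that the sets $F_t^W(u)$ remain in $\mathcal{D}$ for small $t$), which contains $\mathfrak{X}_c(\mathbb{R}^2)$. If $DJ(u)[W]$ exists for all directions $W$ and $W\mapsto DJ(u)[W]$ is linear and continuous, then $J$ is called shape differentiable at $u$ and $DJ(u)[W]$ is its shape derivative at $u$ in direction $W$. ''Shape differentiable'' in the claim means shape differentiable at $u_\varphi$ for every $\varphi\in\mathrm{Diff}_c(\mathbb{R}^2)$. *)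

(* Defs.v *)
From HB Require Import structures.
From mathcomp Require Import all_boot all_order all_algebra.
From mathcomp Require Import all_classical all_reals all_analysis.

Set Implicit Arguments.
Unset Strict Implicit.
Unset Printing Implicit Defensive.

Import Order.TTheory GRing.Theory Num.Theory.
Import numFieldNormedType.Exports.

Local Open Scope classical_set_scope.
Local Open Scope ring_scope.

Notation plane R := (R * R)%type.
Notation vfield R := (plane R -> plane R).

Definition basis_vec (R : realType) (i : bool) : plane R :=
  if i then (0, 1) else (1, 0).

(* The partial derivative of [f] along the multi-index [s], the head of [s]
   being differentiated last. *)
Definition partials (R : realType) (V : normedModType R) (s : seq bool)
    (f : plane R -> V) : plane R -> V :=
  foldr (fun i g => 'D_(basis_vec R i) g) f s.

(* Orders of differentiability range over nat together with [None] = infinity. *)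
Definition le_order (m : nat) (k : option nat) : bool :=
  if k is Some n then (m <= n)%N else true.

Definition Ck (R : realType) (V : normedModType R) (k : option nat)
    (f : plane R -> V) : Prop :=
  (forall s, le_order (size s) k -> continuous (partials s f)) /\
  (forall s i x, le_order (size s).+1 k ->
     derivable (partials s f) x (basis_vec R i)).

Definition fsupport (R : realType) (V : normedModType R) (f : plane R -> V) :
    set (plane R) :=
  closure [set x | f x <> 0].

Definition Ck_compact (R : realType) (V : normedModType R) (k : option nat) :
    set (plane R -> V) :=
  [set f | Ck k f /\ compact (fsupport f)].

Definition Xc (R : realType) : set (vfield R) := @Ck_compact R (plane R) None.

Definition mu2 (R : realType) :=
  ((@lebesgue_measure R) \x (@lebesgue_measure R))%E.

Definition lebesgue_measurable (R : realType) (u : set (plane R)) : Prop :=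
  exists2 B : set (plane R), measurable B &
    (@mu2 R).-negligible ((u `\` B) `|` (B `\` u)).

Definition weak_partial (R : realType) (i : bool) (f g : plane R -> R) : Prop :=
  forall psi : plane R -> R, Ck_compact None psi ->
    \int[@mu2 R]_x (f x * 'D_(basis_vec R i) psi x) =
    - \int[@mu2 R]_x (g x * psi x).

(* [W] lies in the ball of radius [M] of the Sobolev space W^{1,oo}. Since [W]
   is to be integrated to a flow, it is the continuous representative of its
   class modulo null sets. *)
Definition W1oo_ball (R : realType) (M : R) (W : vfield R) : Prop :=
  [/\ continuous W,
      {ae @mu2 R, forall x, `|W x| <= M} &
      forall i, exists G : vfield R,
        [/\ measurable_fun [set: plane R] G,
            {ae @mu2 R, forall x, `|G x| <= M},
            weak_partial i (fst \o W) (fst \o G) &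
            weak_partial i (snd \o W) (snd \o G)]].

Inductive field_class := W1oo | C0 of option nat.

Definition class_fields (R : realType) (cls : field_class) : set (vfield R) :=
  match cls with
  | W1oo => [set W | exists M, W1oo_ball M W]
  | C0 k => @Ck_compact R (plane R) k
  end.

Definition is_seminorm (R : realType) (E : set (vfield R)) (p : vfield R -> R) :
    Prop :=
  (forall f g, E f -> E g -> p (f + g) <= p f + p g) /\
  (forall (a : R) f, E f -> p (a *: f) = `|a| * p f).

(* The locally convex topology of each class, given by its continuous seminorms:
   the norm topology on W^{1,oo}, and on the fields with compact support the
   canonical LF-topology, i.e. the finest locally convex topology inducing on
   the fields supported in a given compact K a topology coarser than that of
   uniform convergence of the partial derivatives of order at most k (each
   finite order if k is infinite). *)
Definition continuous_seminorm (R : realType) (cls : field_class)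
    (p : vfield R -> R) : Prop :=
  is_seminorm (class_fields cls) p /\
  match cls with
  | W1oo => exists C : R, forall W M, W1oo_ball M W -> p W <= C * M
  | C0 k =>
      forall K : set (plane R), compact K ->
      exists m : nat, le_order m k /\
      exists C : R, forall (W : vfield R) (M : R),
        Ck_compact k W -> fsupport W `<=` K ->
        (forall s x, (size s <= m)%N -> `|partials s W x| <= M) ->
        p W <= C * M
  end.

(* [v] is the derivative at [t] of the curve [c] in the space Xc. *)
Definition Xc_derive (R : realType) (c : R -> vfield R) (t : R)
    (v : vfield R) : Prop :=
  Xc v /\
  forall p : vfield R -> R, continuous_seminorm (C0 None) p ->
    p (h^-1 *: (c (t + h) - c t) - v) @[h --> 0^'] --> (0 : R).

Definition Xc_smooth_curve (R : realType) (c : R -> vfield R) : Prop :=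
  exists d : nat -> R -> vfield R,
    [/\ d 0%N = c, (forall n t, Xc (d n t)) &
        forall n t, Xc_derive (d n) t (d n.+1 t)].

Definition is_diffc (R : realType) (f : plane R -> plane R) : Prop :=
  exists g : plane R -> plane R,
    [/\ cancel f g, cancel g f, Ck None f, Ck None g &
        compact (fsupport (fun x => f x - x))].

Record diffc (R : realType) := Diffc {
  diffc_map :> plane R -> plane R ;
  diffc_mapP : is_diffc diffc_map
}.

(* The global chart of the manifold of compactly supported diffeomorphisms; its
   image is open in Xc. The smooth structure and the tangent vectors are read
   in this one-chart atlas. *)
Definition chart (R : realType) (phi : diffc R) : vfield R :=
  fun x => phi x - x.

Definition smooth_R (R : realType) (f : R -> R) : Prop :=
  forall n t, derivable (derive1n n f) t 1.

(* Smoothness in the sense of convenient calculus: smooth curves are mapped to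
   smooth curves. *)
Definition smooth_functional (R : realType) (j : diffc R -> R) : Prop :=
  forall c : R -> diffc R,
    Xc_smooth_curve (fun t => chart (c t)) -> smooth_R (fun t => j (c t)).

Definition tangent_curve (R : realType) (phi : diffc R) (gamma : R -> diffc R) :
    Prop :=
  gamma 0 = phi /\
  forall t, exists v, Xc_derive (fun s => chart (gamma s)) t v.

Definition tangent_equiv (R : realType) (c c' : R -> diffc R) : Prop :=
  c 0 = c' 0 /\
  exists v, Xc_derive (fun s => chart (c s)) 0 v /\
            Xc_derive (fun s => chart (c' s)) 0 v.

(* The identification of the tangent space at [phi] with Xc: the tangent vector
   of [gamma] corresponds to [W] when the curve solving the flow equation of [W]
   from [phi] belongs to the equivalence class of [gamma]. *)
Definition tangent_ident (R : realType) (phi : diffc R) (gamma : R -> diffc R)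
    (W : vfield R) : Prop :=
  exists c : R -> diffc R,
    [/\ tangent_curve phi c, tangent_equiv gamma c &
        forall (t : R) (x : plane R),
          is_derive t (1 : R) (fun s => c s x) (W (c t x))].

Definition push_forward (R : realType) (j : diffc R -> R) (gamma : R -> diffc R) :
    R :=
  derive1 (fun t => j (gamma t)) 0.

Definition is_flow (R : realType) (W : vfield R)
    (eta : R -> plane R -> plane R) : Prop :=
  forall x, eta 0 x = x /\
    forall t : R, is_derive t (1 : R) (fun s => eta s x) (W (eta t x)).

(* Fields of the above classes are complete, and have a unique flow except for
   the class [C0 (Some 0)], where some flow is chosen. *)
Definition flow (R : realType) (W : vfield R) : R -> plane R -> plane R :=
  xget ((fun _ => id) : R -> plane R -> plane R)
    [set eta | is_flow W eta].

(* A functional on a set D of subsets of the plane is represented by a total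
   function [J], whose values outside D are never used. *)
Definition eulerian_quotient (R : realType) (J : set (plane R) -> R)
    (u : set (plane R)) (W : vfield R) (t : R) : R :=
  (J (flow W t @` u) - J u) / t.

Definition eulerian (R : realType) (J : set (plane R) -> R)
    (u : set (plane R)) (W : vfield R) : R :=
  lim (eulerian_quotient J u W t @[t --> 0^'+]).

(* [H] is a space of admissible directions at [u]. *)
Definition admissible (R : realType) (cls : field_class)
    (D : set (set (plane R))) (u : set (plane R)) (H : set (vfield R)) : Prop :=
  [/\ H `<=` class_fields cls,
      Xc (R := R) `<=` H,
      (forall (a : R) V W, H V -> H W -> H (a *: V + W)) &
      forall W, H W -> \forall t \near 0^'+, D (flow W t @` u)].

(* [H] carries the topology induced by its class of fields, so that a linear
   functional on [H] is continuous if and only if it is dominated on [H] by a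
   continuous seminorm of the class. *)
Definition shape_differentiable (R : realType) (cls : field_class)
    (J : set (plane R) -> R) (u : set (plane R)) (H : set (vfield R)) : Prop :=
  [/\ (forall W, H W -> cvg (eulerian_quotient J u W t @[t --> 0^'+])),
      (forall (a : R) V W, H V -> H W ->
         eulerian J u (a *: V + W) = a * eulerian J u V + eulerian J u W) &
      exists p, continuous_seminorm cls p /\
        forall W, H W -> `|eulerian J u W| <= p W].

Definition unit_circle (R : realType) : set (plane R) :=
  [set z | z.1 ^+ 2 + z.2 ^+ 2 = 1].

Definition shape_of (R : realType) (phi : diffc R) : set (plane R) :=
  phi @` @unit_circle R.

(* Main.v *)
Require Import Defs.
From HB Require Import structures.
From mathcomp Require Import all_boot all_order all_algebra.
From mathcomp Require Import all_classical all_reals all_analysis.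
From mathcomp Require Import ring lra.

Set Implicit Arguments.
Unset Strict Implicit.
Unset Printing Implicit Defensive.

Import Order.TTheory GRing.Theory Num.Theory.
Import numFieldNormedType.Exports.

Local Open Scope classical_set_scope.
Local Open Scope ring_scope.

(** The derivative of [j] along a curve [gamma] through [phi] depends only on the
    velocity of [gamma] at [phi].  Granting this, [gamma] can be replaced by the
    curve [c] that solves the flow equation of [W] from [phi]: the two have the
    same velocity by the identification of tangent vectors.  As [W] is
    Lipschitz, its integral curves are unique ([ode_unique]), so [c t] is the
    flow of [W] at time [t] composed with [phi], and [c t] maps the circle onto
    the image of [shape_of phi] under the flow ([flow_shape]).  The difference
    quotients of [j] along [c] are then those of the Eulerian derivative, and the
    two derivatives agree.

    The real issue is that [j] is only known to be smooth along smooth curves,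
    whereas [gamma] and [c] are merely differentiable.  The bridge is
    [comparison]: if two differentiable curves have the same velocity at time
    zero, the difference of the values of [j] along them is negligible with
    respect to [t].  Were it not, there would be times [t_n], tending to zero as
    fast as one likes, at which this difference exceeds [e * |t_n|].  Near
    time zero, the displacements of both curves from [phi] are supported in a
    fixed compact set ([near_common_support]), and the points reached at the times
    [t_n] converge to [phi] faster than any power of [1 / n] together with all
    their derivatives.  One can therefore glue, by means of bump functions, a
    smooth curve that passes from one point of each pair to the other in a time
    much shorter than [|t_n|] ([Xc_derive_glued], [glued_at]).  Along it [j] is
    smooth, hence Lipschitz near time zero, a contradiction.
    Comparing with the smooth curve [chart phi + a * sin (t / a) * v] shows that
    the derivative exists and depends only on the velocity [v]
    ([directional_derivative]).

    These constructions require that a small perturbation of a compactly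
    supported diffeomorphism be one too ([diffc_perturbation]).  It is bijective
    by a contraction argument, and its inverse [G] is smooth because the partial
    derivatives of [G] are smooth functions composed with [G], by Cramer's rule
    ([smooth_inverse]). *)

(** * First-order calculus in the plane *)

Lemma small_near0 (R : realType) (e : R) : 0 < e ->
  \forall h \near (0 : R), `|h| <= e.
Proof.
move=> e0; apply/nbhs_normP; exists e => // h /=.
by rewrite /ball_ /= sub0r normrN => /ltW.
Qed.

Lemma is_deriveP (R : realType) (V W : normedModType R) (f : V -> W) x v d :
  is_derive x v f d <->
  forall e : R, 0 < e ->
    \forall h \near (0 : R), `|f (h *: v + x) - f x - h *: d| <= e * `|h|.
Proof.
have E (h : R) : h != 0 ->
    h^-1 *: (f (h *: v + x) - f x) - d = h^-1 *: (f (h *: v + x) - f x - h *: d).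
  by move=> h0; rewrite [RHS]scalerBr scalerA mulVf // scale1r.
split.
- case=> /cvg_ex[l fl] dE e e0.
  have ld : l = d by rewrite -dE /derive; apply/esym/cvg_lim.
  rewrite {}ld in fl.
  have /cvgrPdist_le/(_ e e0) := fl.
  rewrite /= near_withinE; apply: filterS => h H.
  have [->|h0] := eqVneq h 0.
    by rewrite !scale0r add0r !subrr normr0 normr0 mulr0.
  have := H h0; rewrite distrC /= E // normrZ normfV.
  by rewrite ler_pdivrMl ?normr_gt0 // mulrC.
- move=> H; suff fl : h^-1 *: (f (h *: v + x) - f x) @[h --> 0^'] --> d.
    split; first by apply/cvg_ex; exists d.
    exact: cvg_lim fl.
  apply/cvgrPdist_le => e e0; rewrite near_withinE.
  near=> h => h0; rewrite distrC E // normrZ normfV ler_pdivrMl ?normr_gt0 //.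
  by rewrite mulrC; near: h; exact: H.
Unshelve. all: by end_near. Qed.

Lemma is_derive_slice1 (R : realType) (V : normedModType R) (f : plane R -> V)
    (x : plane R) d :
  is_derive x (basis_vec R false) f d <->
  is_derive x.1 (1 : R) (fun t => f (t, x.2)) d.
Proof.
have E h : (h *: basis_vec R false + x) = (h *: 1 + x.1, x.2) :> plane R.
  by case: x => a b /=; congr pair => /=; rewrite scaler0 add0r.
split=> /is_deriveP H; apply/is_deriveP => e e0; have := H e e0;
  by apply: filterS => h; rewrite E; case: (x).
Qed.

Lemma is_derive_slice2 (R : realType) (V : normedModType R) (f : plane R -> V)
    (x : plane R) d :
  is_derive x (basis_vec R true) f d <->
  is_derive x.2 (1 : R) (fun t => f (x.1, t)) d.
Proof.
have E h : (h *: basis_vec R true + x) = (x.1, h *: 1 + x.2) :> plane R.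
  by case: x => a b /=; congr pair => /=; rewrite scaler0 add0r.
split=> /is_deriveP H; apply/is_deriveP => e e0; have := H e e0;
  by apply: filterS => h; rewrite E; case: (x).
Qed.

Lemma mean_value (R : realType) (f df : R -> R) (a b : R) :
  (forall t, is_derive t (1 : R) f (df t)) ->
  exists c, `|c - a| <= `|b - a| /\ f b - f a = df c * (b - a).
Proof.
move=> fd; have fc : continuous f.
  by move=> t; apply/differentiable_continuous/derivable1_diffP; case: (fd t).
have [ab|ba] := leP a b.
- have [c] := MVT_segment ab (fun x _ => fd x) (continuous_subspaceT fc).
  rewrite in_itv /= => /andP[ac cb] E; exists c; split=> //.
  by rewrite !ger0_norm ?subr_ge0 // lerB.
- have [c] := MVT_segment (ltW ba) (fun x _ => fd x) (continuous_subspaceT fc).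
  rewrite in_itv /= => /andP[ac cb] E; exists c; split.
    by rewrite !ler0_norm ?subr_le0 ?(ltW ba) // !opprB lerB.
  by rewrite -[LHS]opprB E -mulrN opprB.
Qed.

Definition has_partials (R : realType) (V : normedModType R) (f : plane R -> V) :=
  forall i x, derivable f x (basis_vec R i).

(** Moving first horizontally, then vertically, the mean value theorem applies
    to each leg. *)
Lemma mean_value_plane (R : realType) (f : plane R -> R) (x y : plane R) :
  has_partials f ->
  exists p q : plane R, [/\ `|p - x| <= `|y - x|, `|q - x| <= `|y - x| &
    f y - f x = 'D_(basis_vec R false) f p * (y.1 - x.1) +
                'D_(basis_vec R true) f q * (y.2 - x.2)].
Proof.
move=> df.
have d1 t : is_derive t (1 : R) (fun t => f (t, y.2))
    ('D_(basis_vec R false) f (t, y.2)).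
  exact/(is_derive_slice1 f (t, y.2))/derivableP.
have d2 t : is_derive t (1 : R) (fun t => f (x.1, t))
    ('D_(basis_vec R true) f (x.1, t)).
  exact/(is_derive_slice2 f (x.1, t))/derivableP.
have [c [ca cE]] := mean_value x.1 y.1 d1.
have [d [da dE]] := mean_value x.2 y.2 d2.
exists (c, y.2), (x.1, d); split.
- rewrite !prod_normE /= ge_max le_max ca /= le_max lexx orbT //.
- by rewrite !prod_normE /= subrr normr0 ge_max !le_max da normr_ge0 orbT.
- by rewrite -cE -dE -!surjective_pairing addrA subrK.
Qed.

Lemma norm_fst (R : realType) (x : plane R) : `|x.1| <= `|x|.
Proof. by rewrite prod_normE le_max lexx. Qed.

Lemma norm_snd (R : realType) (x : plane R) : `|x.2| <= `|x|.
Proof. by rewrite prod_normE le_max lexx orbT. Qed.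

Lemma lipschitz_of_partials (R : realType) (f : plane R -> R) (M : R) :
  has_partials f -> (forall i x, `|'D_(basis_vec R i) f x| <= M) ->
  forall x y, `|f y - f x| <= 2 * M * `|y - x|.
Proof.
move=> df fM x y; have [p [q [_ _ ->]]] := mean_value_plane x y df.
rewrite (le_trans (ler_normD _ _)) // !normrM.
rewrite -mulrA mulr_natl mulr2n lerD // ler_pM //.
- exact: (norm_fst (y - x)).
- exact: (norm_snd (y - x)).
Qed.

(** Both intermediate points of the mean value theorem stay in a ball where the
    partial derivatives are nearly constant: this is how continuous partial
    derivatives give a total differential. *)
Lemma first_order (R : realType) (f : plane R -> R) (x : plane R) (e : R) :
  has_partials f -> (forall i, continuous ('D_(basis_vec R i) f)) -> 0 < e ->
  \forall y \near x, `|f y - f x - ('D_(basis_vec R false) f x * (y.1 - x.1) +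
     'D_(basis_vec R true) f x * (y.2 - x.2))| <= e * `|y - x|.
Proof.
move=> df cf e0; have e20 : 0 < e / 2 by rewrite divr_gt0.
have H i : exists2 r, 0 < r & forall p, `|p - x| < r ->
    `|'D_(basis_vec R i) f p - 'D_(basis_vec R i) f x| <= e / 2.
  have /cvgrPdist_le/(_ _ e20)/nbhs_normP[r /= r0 Hr] := cf i x.
  by exists r => // p px; rewrite distrC; apply: Hr; rewrite /ball_ /= distrC.
have [r1 r10 H1] := H false; have [r2 r20 H2] := H true.
apply/nbhs_normP; exists (Num.min r1 r2); first by rewrite /= lt_min r10.
move=> y; rewrite /ball_ /= lt_min distrC => /andP[y1 y2].
have [p [q [px qx ->]]] := mean_value_plane x y df.
rewrite [X in `|X|](_ : _ =
    ('D_(basis_vec R false) f p - 'D_(basis_vec R false) f x) * (y.1 - x.1) +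
    ('D_(basis_vec R true) f q - 'D_(basis_vec R true) f x) * (y.2 - x.2));
  last by ring.
rewrite (le_trans (ler_normD _ _)) // !normrM.
rewrite (splitr e) mulrDl lerD // ler_pM //.
- by apply: H1; rewrite (le_lt_trans px).
- exact: (norm_fst (y - x)).
- by apply: H2; rewrite (le_lt_trans qx).
- exact: (norm_snd (y - x)).
Qed.

Lemma is_derive_continuous (R : realType) (V W : normedModType R) (f : V -> W)
    x v d :
  is_derive x v f d -> f (h *: v + x) @[h --> (0 : R)] --> f x.
Proof.
move=> /is_deriveP H; apply/cvgrPdist_le => e e0.
have d0 : 0 < `|d| + 1 by rewrite ltr_wpDl.
near=> h; rewrite distrC.
have -> : f (h *: v + x) - f x = (f (h *: v + x) - f x - h *: d) + h *: d.
  by rewrite subrK.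
rewrite (le_trans (ler_normD _ _)) // normrZ.
have : `|f (h *: v + x) - f x - h *: d| <= 1 * `|h|.
  by near: h; exact: H.
have : `|h| <= e / (`|d| + 1).
  by near: h; apply: small_near0; rewrite divr_gt0.
rewrite ler_pdivlMr // => A B; apply: le_trans A.
by rewrite mulrDr mulr1 addrC lerD // -[leRHS]mul1r.
Unshelve. all: by end_near. Qed.

Lemma chain_rule_plane (R : realType) (V : normedModType R) (f : plane R -> R)
    (G : V -> plane R) (y v : V) (d1 d2 : R) :
  has_partials f -> (forall i, continuous ('D_(basis_vec R i) f)) ->
  is_derive y v (fst \o G) d1 -> is_derive y v (snd \o G) d2 ->
  is_derive y v (f \o G) ('D_(basis_vec R false) f (G y) * d1 +
                          'D_(basis_vec R true) f (G y) * d2).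
Proof.
move=> df cf g1 g2; set a : R := 'D_ _ f _; set b : R := 'D_ _ f _.
apply/is_deriveP => e e0.
have Gc : G (h *: v + y) @[h --> (0 : R)] --> G y.
  have E z : G z = ((fst \o G) z, (snd \o G) z) by rewrite /=; case: (G z).
  under eq_fun do rewrite E; rewrite (E y).
  exact: cvg_pair (is_derive_continuous g1) (is_derive_continuous g2).
set A := `|a| + `|b| + 1; have A0 : 0 < A by rewrite ltr_wpDl // addr_ge0.
set C : R := `|d1| + `|d2| + 1; have C0 : 0 < C by rewrite ltr_wpDl // addr_ge0.
(* Half of the error [e] goes to the expansions of the components of [G], whose
   remainders get multiplied by [a] and [b]; the other half goes to the expansion
   of [f] along an increment of [G] of size at most [C * |h|]. *)
set e1 := Num.min 1 (e / 2 / A).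
have e10 : 0 < e1 by rewrite lt_min ltr01 /= !divr_gt0.
have e20 : 0 < e / 2 / C by rewrite !divr_gt0.
have F0 := Gc _ (first_order (G y) df cf e20).
have F : \forall h \near (0 : R),
    `|f (G (h *: v + y)) - f (G y) - (a * ((G (h *: v + y)).1 - (G y).1) +
       b * ((G (h *: v + y)).2 - (G y).2))|
      <= e / 2 / C * `|G (h *: v + y) - G y| by exact: F0.
move: g1 g2 => /is_deriveP/(_ _ e10)/= g1 /is_deriveP/(_ _ e10)/= g2.
near=> h.
have E0 : `|f (G (h *: v + y)) - f (G y) - (a * ((G (h *: v + y)).1 - (G y).1) +
       b * ((G (h *: v + y)).2 - (G y).2))|
      <= e / 2 / C * `|G (h *: v + y) - G y| by near: h; exact: F.
have E1 : `|(G (h *: v + y)).1 - (G y).1 - h *: d1| <= e1 * `|h|.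
  by near: h; exact: g1.
have E2 : `|(G (h *: v + y)).2 - (G y).2 - h *: d2| <= e1 * `|h|.
  by near: h; exact: g2.
move: E0 E1 E2; set D1 := _.1 - _; set D2 := _.2 - _ => E0 E1 E2.
have bnd (D d : R) : `|D - h *: d| <= e1 * `|h| -> `|D| <= (`|d| + 1) * `|h|.
  move=> H; have := ler_normD (D - h *: d) (h *: d).
  rewrite subrK normrZ => N; apply: le_trans N _.
  rewrite mulrDl mul1r [leRHS]addrC lerD //; last by rewrite mulrC.
  apply: le_trans H _; rewrite -[leRHS]mul1r; apply: ler_wpM2r => //.
  by rewrite ge_min lexx.
have GC : `|G (h *: v + y) - G y| <= C * `|h|.
  have A1 := bnd _ _ E1; have A2 := bnd _ _ E2.
  rewrite prod_normE ge_max; apply/andP; split.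
    apply: (@le_trans _ _ ((`|d1| + 1) * `|h|)); first exact: A1.
    by apply: ler_wpM2r; rewrite // /C lerD2r lerDl.
  apply: (@le_trans _ _ ((`|d2| + 1) * `|h|)); first exact: A2.
  by apply: ler_wpM2r; rewrite // /C lerD2r lerDr.
rewrite /= [X in `|X|](_ : _ = (f (G (h *: v + y)) - f (G y) - (a * D1 + b * D2))
  + (a * (D1 - h *: d1) + b * (D2 - h *: d2))); last first.
  by rewrite /GRing.scale /=; ring.
rewrite (le_trans (ler_normD _ _)) // (splitr e) mulrDl lerD //.
  apply: le_trans E0 _; apply: le_trans (ler_wpM2l (ltW e20) GC) _.
  by rewrite mulrA divfK ?gt_eqF.
rewrite (le_trans (ler_normD _ _)) // !normrM.
apply: (@le_trans _ _ ((`|a| + `|b|) * (e1 * `|h|))).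
  by rewrite mulrDl lerD // ler_wpM2l.
rewrite mulrA ler_wpM2r //.
apply: (@le_trans _ _ (A * (e / 2 / A))); last by rewrite mulrC divfK ?gt_eqF.
rewrite ler_pM // ?addr_ge0 ?(ltW e10) //; first by rewrite lerDl.
by rewrite ge_min lexx orbT.
Unshelve. all: by end_near. Qed.

(** * Smooth functions and compactly supported fields *)

Lemma is_derive_fst (R : realType) (V : normedModType R) (f : V -> plane R)
    x v d :
  is_derive x v f d -> is_derive x v (fst \o f) d.1.
Proof.
move=> /is_deriveP H; apply/is_deriveP => e /H; apply: filterS => h.
exact: le_trans (norm_fst _).
Qed.

Lemma is_derive_snd (R : realType) (V : normedModType R) (f : V -> plane R)
    x v d :
  is_derive x v f d -> is_derive x v (snd \o f) d.2.
Proof.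
move=> /is_deriveP H; apply/is_deriveP => e /H; apply: filterS => h.
exact: le_trans (norm_snd _).
Qed.

Lemma is_derive_pair (R : realType) (V : normedModType R) (f : V -> plane R)
    x v (d : plane R) :
  is_derive x v (fst \o f) d.1 -> is_derive x v (snd \o f) d.2 ->
  is_derive x v f d.
Proof.
move=> /is_deriveP H1 /is_deriveP H2; apply/is_deriveP => e e0.
have := H1 _ e0; apply: filterS2 (H2 _ e0) => h h2 h1.
by rewrite prod_normE ge_max; apply/andP; split.
Qed.

Section Smooth.
Variable R : realType.
Local Notation e_ := (basis_vec R).

Section SmoothIn.
Variable V : normedModType R.
Implicit Types f g : plane R -> V.

Lemma partials_rcons s i f : partials (rcons s i) f = partials s ('D_(e_ i) f).
Proof. by rewrite /partials foldr_rcons. Qed.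

Lemma smoothP f : Ck None f <->
  forall s, continuous (partials s f) /\ has_partials (partials s f).
Proof.
split=> [[H1 H2] s|H]; first by split; [exact: H1|move=> i x; exact: H2].
by split=> [s _|s i x _]; [case: (H s)|case: (H s) => _; exact].
Qed.

Lemma smooth_continuous f : Ck None f -> continuous f.
Proof. by move=> /smoothP/(_ [::])[]. Qed.

Lemma smooth_has_partials f : Ck None f -> has_partials f.
Proof. by move=> /smoothP/(_ [::])[]. Qed.

Lemma smooth_derive i f : Ck None f -> Ck None ('D_(e_ i) f).
Proof. by move=> /smoothP H; apply/smoothP => s; rewrite -partials_rcons. Qed.

Lemma smooth_partials s f : Ck None f -> Ck None (partials s f).
Proof. by move=> Hf; elim: s => //= i s; exact: smooth_derive. Qed.

(** A partial derivative of order [n + 1] is a partial derivative of order [n] of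
    a function that is again in the class.  This coinduction principle spares
    the formulas for the higher derivatives of products, inverses and
    composites. *)
Lemma smooth_coind (S : set (plane R -> V)) :
  (forall f, S f -> [/\ continuous f, has_partials f &
     forall i, S ('D_(e_ i) f)]) ->
  forall f, S f -> Ck None f.
Proof.
move=> HS f Sf; apply/smoothP => s; elim/last_ind: s f Sf => [|s i IH] f Sf.
  by have [? ? _] := HS _ Sf.
by rewrite partials_rcons; apply: IH; have [_ _] := HS _ Sf; exact.
Qed.

Lemma derive_lin i (a : R) f g : has_partials f -> has_partials g ->
  'D_(e_ i) (a *: f + g) = a *: 'D_(e_ i) f + 'D_(e_ i) g.
Proof.
move=> df dg; apply/funext => x.
by rewrite deriveD ?deriveZ //; exact: derivableZ.
Qed.

Lemma partials_lin s (a : R) f g : Ck None f -> Ck None g ->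
  partials s (a *: f + g) = a *: partials s f + partials s g.
Proof.
move=> df dg; elim: s => //= i s ->.
by rewrite derive_lin //; exact/smooth_has_partials/smooth_partials.
Qed.

Lemma smooth_lin (a : R) f g : Ck None f -> Ck None g -> Ck None (a *: f + g).
Proof.
move=> sf sg.
apply: (@smooth_coind [set h | exists f' g',
  [/\ Ck None f', Ck None g' & h = a *: f' + g']]); last by exists f, g.
move=> _ [f' [g' [sf' sg' ->]]]; split.
- by move=> x; apply: continuousD; first apply: continuousZl_tmp;
    exact: smooth_continuous.
- by move=> i x; apply: derivableD; first apply: derivableZ;
    exact: smooth_has_partials.
- move=> i; exists ('D_(e_ i) f'), ('D_(e_ i) g').
  by split; [exact: smooth_derive|exact: smooth_derive|
    rewrite derive_lin //; exact: smooth_has_partials].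
Qed.

Lemma smooth_cst (c : V) : Ck None (fun _ : plane R => c).
Proof.
apply: (@smooth_coind [set h | exists c, h = fun=> c]); last by exists c.
move=> _ [c' ->]; split=> [x|i x|i].
- exact: cvg_cst.
- exact: derivable_cst.
- by exists 0; apply/funext => x; exact: derive_cst.
Qed.

Lemma smoothD f g : Ck None f -> Ck None g -> Ck None (f + g).
Proof. by move=> sf sg; have := smooth_lin 1 sf sg; rewrite scale1r. Qed.

Lemma smoothZ (a : R) f : Ck None f -> Ck None (a *: f).
Proof.
move=> sf; rewrite -[_ *: _]addr0; exact: smooth_lin (smooth_cst 0).
Qed.

Lemma smoothB f g : Ck None f -> Ck None g -> Ck None (f - g).
Proof.
by move=> sf sg; rewrite addrC -scaleN1r; exact: smooth_lin.
Qed.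

Lemma fsupport_sub f K : closed K -> (forall x, ~ K x -> f x = 0) ->
  fsupport f `<=` K.
Proof.
move=> cK fK p cp; apply: cK => B Bp; have [q [fq Bq]] := cp B Bp.
by exists q; split=> //; apply: contrapT => /fK.
Qed.

Lemma out_fsupport f x : ~ fsupport f x -> f x = 0.
Proof. by move=> fx; apply: contrapT => fx0; apply: fx; exact: subset_closure. Qed.

Lemma near_out_fsupport f x : ~ fsupport f x -> \forall y \near x, f y = 0.
Proof.
move=> fx; have : open_nbhs x (~` fsupport f).
  by split=> //; exact/closed_openC/closed_closure.
by move=> /open_nbhs_nbhs; apply: filterS => y; exact: out_fsupport.
Qed.

Lemma fsupport_derive f v : fsupport ('D_v f) `<=` fsupport f.
Proof.
apply: fsupport_sub; first exact: closed_closure.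
move=> x /near_out_fsupport fx.
by rewrite (near_eq_derive (g := cst 0)) ?derive_cst.
Qed.

Lemma fsupport_partials s f : fsupport (partials s f) `<=` fsupport f.
Proof. by elim: s => //= i s IH; apply: subset_trans IH; exact: fsupport_derive. Qed.

Lemma bounded_partials s f : Ck_compact None f ->
  exists2 M, 0 <= M & forall x, `|partials s f x| <= M.
Proof.
move=> [sf cf]; have cpf := smooth_continuous (smooth_partials s sf).
have /compact_bounded[M [_ HM]] : compact (partials s f @` fsupport f).
  by apply: continuous_compact => //; exact: continuous_subspaceT.
exists (`|M| + 1); first by rewrite addr_ge0.
move=> x; have [fx|fx] := pselect (fsupport f x).
  apply: (HM (`|M| + 1)); last by exists x.
  by rewrite (le_lt_trans (ler_norm M)) // ltrDl.
rewrite out_fsupport ?normr0 ?addr_ge0 //.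
by apply: contra_not fx; exact: fsupport_partials.
Qed.

Lemma Ck_compact_lin (a : R) f g : Ck_compact None f -> Ck_compact None g ->
  Ck_compact None (a *: f + g).
Proof.
move=> [sf cf] [sg cg]; split; first exact: smooth_lin.
apply: subclosed_compact (compactU cf cg) _; first exact: closed_closure.
apply: fsupport_sub; first by apply: closedU; exact: closed_closure.
move=> x /not_orP[fx gx].
by rewrite fctE /= [in LHS]/GRing.scale /= !out_fsupport // scaler0 addr0.
Qed.

Lemma Ck_compact0 : Ck_compact None (0 : plane R -> V).
Proof.
split; first exact: (smooth_cst 0).
apply: subclosed_compact compact0 _; first exact: closed_closure.
by apply: fsupport_sub; first exact: closed0.
Qed.

Lemma Ck_compactZ (a : R) f : Ck_compact None f -> Ck_compact None (a *: f).
Proof.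
by move=> cf; rewrite -[_ *: _]addr0; exact: Ck_compact_lin Ck_compact0.
Qed.

Lemma Ck_compactD f g : Ck_compact None f -> Ck_compact None g ->
  Ck_compact None (f + g).
Proof. by move=> cf cg; rewrite -[f]scale1r; exact: Ck_compact_lin. Qed.

Lemma Ck_compactB f g : Ck_compact None f -> Ck_compact None g ->
  Ck_compact None (f - g).
Proof. by move=> cf cg; rewrite addrC -scaleN1r; exact: Ck_compact_lin. Qed.

End SmoothIn.

Lemma smooth_id : Ck None (id : plane R -> plane R).
Proof.
apply: (@smooth_coind _ [set h | h = id \/ exists c, h = fun=> c]); last by left.
move=> f Sf; have sc c : Ck None (fun _ : plane R => c : plane R) := smooth_cst c.
case: Sf => [->|[c ->]]; split.
- by move=> x; exact: cvg_id.
- by move=> i x; exact: derivable_id.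
- by move=> i; right; exists (e_ i); apply/funext => x; exact: derive_id.
- exact: smooth_continuous.
- exact: smooth_has_partials.
- by move=> i; right; exists 0; apply/funext => x; exact: derive_cst.
Qed.

Lemma derive_fst i (f : vfield R) : has_partials f ->
  'D_(e_ i) (fst \o f) = fst \o 'D_(e_ i) f.
Proof.
move=> df; apply/funext => x; by have [_ ->] := is_derive_fst (derivableP (df i x)).
Qed.

Lemma derive_snd i (f : vfield R) : has_partials f ->
  'D_(e_ i) (snd \o f) = snd \o 'D_(e_ i) f.
Proof.
move=> df; apply/funext => x; by have [_ ->] := is_derive_snd (derivableP (df i x)).
Qed.

Lemma smooth_fst (f : vfield R) : Ck None f -> Ck None (fst \o f).
Proof.
move=> sf; pose S : set (plane R -> R) :=
  [set h | exists g : vfield R, Ck None g /\ h = fst \o g].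
apply: (@smooth_coind _ S); last by exists f.
move=> _ [g [sg ->]]; split.
- by move=> x; apply: continuous_comp; [exact: smooth_continuous|exact: cvg_fst].
- move=> i x; have dg := smooth_has_partials sg.
  by have [] := is_derive_fst (derivableP (dg i x)).
- move=> i; exists ('D_(e_ i) g); split; first exact: smooth_derive.
  exact/derive_fst/smooth_has_partials.
Qed.

Lemma smooth_snd (f : vfield R) : Ck None f -> Ck None (snd \o f).
Proof.
move=> sf; pose S : set (plane R -> R) :=
  [set h | exists g : vfield R, Ck None g /\ h = snd \o g].
apply: (@smooth_coind _ S); last by exists f.
move=> _ [g [sg ->]]; split.
- by move=> x; apply: continuous_comp; [exact: smooth_continuous|exact: cvg_snd].
- move=> i x; have dg := smooth_has_partials sg.
  by have [] := is_derive_snd (derivableP (dg i x)).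
- move=> i; exists ('D_(e_ i) g); split; first exact: smooth_derive.
  exact/derive_snd/smooth_has_partials.
Qed.

Lemma pair_comp_eq (T : Type) (f : T -> plane R) :
  f = (fun x => ((fst \o f) x, (snd \o f) x)).
Proof. by apply/funext => x /=; case: (f x). Qed.

Lemma smooth_pair (f : vfield R) : Ck None (fst \o f) -> Ck None (snd \o f) ->
  Ck None f.
Proof.
move=> sf1 sf2; pose S : set (vfield R) :=
  [set h : vfield R | Ck None (fst \o h) /\ Ck None (snd \o h)].
have HS : forall f, S f -> [/\ continuous f, has_partials f &
    forall i, S ('D_(e_ i) f)]; last by exact: (smooth_coind HS).
move=> {sf1 sf2} {}f [s1 s2].
have df : has_partials f.
  move=> i x; have p1 := smooth_has_partials s1.
  have p2 := smooth_has_partials s2.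
  have d1 := derivableP (p1 i x); have d2 := derivableP (p2 i x).
  by have [] := @is_derive_pair _ _ f x (e_ i) (_, _) d1 d2.
split; [|exact: df|].
- have c1 : continuous (fst \o f) by exact: smooth_continuous.
  have c2 : continuous (snd \o f) by exact: smooth_continuous.
  move=> x; have H := cvg_pair (c1 x) (c2 x).
  by rewrite (pair_comp_eq f); exact: H.
- move=> i; split.
    by rewrite -(derive_fst i df); exact: smooth_derive.
  by rewrite -(derive_snd i df); exact: smooth_derive.
Qed.

(** By the Leibniz rule, the algebra generated by the smooth functions and
    [u^-1] is stable under partial derivatives. *)
Inductive inverse_algebra (u : plane R -> R) : (plane R -> R) -> Prop :=
| IA_smooth f : Ck None f -> inverse_algebra u f
| IA_inv : inverse_algebra u (fun x => (u x)^-1)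
| IA_add f g : inverse_algebra u f -> inverse_algebra u g ->
    inverse_algebra u (f + g)
| IA_mul f g : inverse_algebra u f -> inverse_algebra u g ->
    inverse_algebra u (f * g).

Lemma smooth_inverse_algebra (u : plane R -> R) : Ck None u ->
  (forall x, u x != 0) -> forall f, inverse_algebra u f -> Ck None f.
Proof.
move=> su u0; apply: smooth_coind => f.
elim=> {f} [f sf||f g _ [cf df sf] _ [cg dg sg]|f g Af [cf df sf] Ag [cg dg sg]].
- split; first exact: smooth_continuous.
  + exact: smooth_has_partials.
  + by move=> i; apply: IA_smooth; exact: smooth_derive.
- have du := smooth_has_partials su.
  split.
  + by move=> x; apply: continuousV => //; exact: smooth_continuous.
  + by move=> i x; apply: derivableV.
  + move=> i; have -> : 'D_(e_ i) (fun x => (u x)^-1) =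
       ((-1 : R) *: 'D_(e_ i) u) *
         ((fun x => (u x)^-1) * (fun x => (u x)^-1)).
      apply/funext => x; rewrite deriveV // /GRing.mul /= /GRing.scale /=.
      rewrite -expr2 exprVn; rewrite /GRing.scale /=.
      by rewrite mulNr mulN1r mulrC mulNr.
    apply: IA_mul; last by apply: IA_mul; exact: IA_inv.
    by apply: IA_smooth; apply: smoothZ; exact: smooth_derive.
- split.
  + by move=> x; apply: continuousD; [exact: cf|exact: cg].
  + by move=> i x; exact: derivableD.
  + move=> i; have -> : 'D_(e_ i) (f + g) = 'D_(e_ i) f + 'D_(e_ i) g.
      by apply/funext => x; rewrite deriveD.
    exact: IA_add.
- split.
  + by move=> x; apply: continuousM; [exact: cf|exact: cg].
  + by move=> i x; exact: derivableM.
  + move=> i; have -> : 'D_(e_ i) (f * g) = f * 'D_(e_ i) g + g * 'D_(e_ i) f.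
      by apply/funext => x; rewrite deriveM.
    by apply: IA_add; exact: IA_mul.
Qed.

Lemma smoothM (f g : plane R -> R) : Ck None f -> Ck None g -> Ck None (f * g).
Proof.
move=> sf sg; apply: (@smooth_inverse_algebra (fun=> 1)).
- exact: smooth_cst.
- by move=> x; exact: oner_neq0.
- by apply: IA_mul; exact: IA_smooth.
Qed.

Lemma smoothV (f : plane R -> R) : Ck None f -> (forall x, f x != 0) ->
  Ck None (fun x => (f x)^-1).
Proof. by move=> sf f0; apply: smooth_inverse_algebra (IA_inv f). Qed.

Lemma lipschitz_vfield (W : vfield R) (M : R) : has_partials W ->
  (forall i x, `|'D_(e_ i) W x| <= M) ->
  forall x y, `|W y - W x| <= 2 * M * `|y - x|.
Proof.
move=> dW WM x y.
have d1 : has_partials (fst \o W).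
  by move=> i z; have [] := is_derive_fst (derivableP (dW i z)).
have d2 : has_partials (snd \o W).
  by move=> i z; have [] := is_derive_snd (derivableP (dW i z)).
rewrite prod_normE ge_max; apply/andP; split.
- apply: (lipschitz_of_partials (f := fst \o W)) => // i z.
  have [_ ->] := is_derive_fst (derivableP (dW i z)).
  exact: le_trans (norm_fst _) (WM i z).
- apply: (lipschitz_of_partials (f := snd \o W)) => // i z.
  have [_ ->] := is_derive_snd (derivableP (dW i z)).
  exact: le_trans (norm_snd _) (WM i z).
Qed.

Lemma Xc_lipschitz (W : vfield R) : Xc W ->
  exists2 L, 0 < L & forall x y, `|W y - W x| <= L * `|y - x|.
Proof.
move=> XW; have [M0 M00 H0] := bounded_partials [:: false] XW.
have [M1 M10 H1] := bounded_partials [:: true] XW.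
exists (2 * (M0 + M1 + 1)); first by rewrite mulr_gt0 // ltr_wpDl // addr_ge0.
move=> x y; apply: lipschitz_vfield.
  by case: XW => sW _; exact: smooth_has_partials.
case=> z.
- by apply: (le_trans (H1 z)); rewrite addrAC lerDr addr_ge0.
- by apply: (le_trans (H0 z)); rewrite -addrA lerDl addr_ge0.
Qed.

End Smooth.

(** * Small perturbations of a diffeomorphism *)

Section SmoothInverse.
Variable R : realType.
Local Notation e_ := (basis_vec R).

Lemma lipschitz_continuous (T : vfield R) (L : R) : 0 < L ->
  (forall x y, `|T y - T x| <= L * `|y - x|) -> continuous T.
Proof.
move=> L0 HT; suff H : forall x : plane R, T y @[y --> x] --> T x by exact: H.
move=> x; apply/cvgrPdist_le => e e0.
have H : \forall y \near x, `|x - y| < e / L.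
  by apply/nbhs_normP; exists (e / L); first by rewrite /= divr_gt0.
apply: filterS H => y; rewrite ltr_pdivlMr // distrC => xy; rewrite distrC.
by rewrite (le_trans (HT _ _)) // mulrC ltW.
Qed.

(** The plane being locally compact, the displacement [|x - T x|] attains its
    minimum on a ball stable under [T]; a contraction can only have zero
    minimal displacement. *)
Lemma contraction_fixpoint_plane (T : vfield R) :
  (forall x y, `|T y - T x| <= 2^-1 * `|y - x|) -> exists x, T x = x.
Proof.
move=> HT; pose r := 2 * `|T 0|.
have r0 : 0 <= r by rewrite mulr_ge0.
pose B : set (plane R) := (`[- r, r]%classic `*` `[- r, r]%classic).
have BP x : B x <-> `|x| <= r.
  rewrite /B /= !in_itv /= prod_normE ge_max -!ler_norml.
  by split=> [[-> ->]|/andP].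
have TB x : B x -> B (T x).
  move=> /BP xr; apply/BP; have := HT 0 x; rewrite subr0 => H.
  rewrite -[T x](subrK (T 0)) (le_trans (ler_normD _ _)) //.
  have : 2^-1 * `|x| <= 2^-1 * r by rewrite ler_wpM2l.
  by rewrite /r; lra.
have cT : continuous T by apply: (lipschitz_continuous _ HT); rewrite invr_gt0.
have cB : compact B by apply: compact_setX; exact: segment_compact.
have [||z Bz zmin] := @compact_EVT_min _ R (fun x : plane R => `|x - T x|) B _ cB _.
- by exists 0; apply/BP; rewrite normr0.
- have cd : continuous (fun x : plane R => x - T x : plane R).
    by move=> x; apply: continuousB; [exact: cvg_id|exact: cT].
  apply: continuous_subspaceT => x.
  exact: (continuous_comp (cd x) (@norm_continuous _ (plane R) _)).
exists z; have := zmin (T z); rewrite !inE in Bz * => /(_ (TB _ Bz)).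
move=> /le_trans/(_ (HT _ _)) H.
have /eqP : `|z - T z| = 0.
  by apply/eqP; rewrite eq_le normr_ge0 andbT; move: H; lra.
by rewrite normr_eq0 subr_eq0 => /eqP.
Qed.

Lemma derive_direction (f : plane R -> R) (x w : plane R) : Ck None f ->
  is_derive x w f ('D_(e_ false) f x * w.1 + 'D_(e_ true) f x * w.2).
Proof.
move=> sf; apply: (@chain_rule_plane R _ f id x w).
- exact: smooth_has_partials.
- by move=> i; apply: smooth_continuous; exact: smooth_derive.
- exact: is_derive_fst (is_derive_id _ _).
- exact: is_derive_snd (is_derive_id _ _).
Qed.

Variables (F G : vfield R) (L : R).
Hypotheses (sF : Ck None F) (FK : cancel F G) (GK : cancel G F).
Hypotheses (L0 : 0 < L) (GL : forall y z, `|G z - G y| <= L * `|z - y|).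

Let F1 := fst \o F.
Let F2 := snd \o F.
Let sF1 : Ck None F1. Proof. exact: smooth_fst. Qed.
Let sF2 : Ck None F2. Proof. exact: smooth_snd. Qed.
Let a : plane R -> R := 'D_(e_ false) F1.
Let b : plane R -> R := 'D_(e_ true) F1.
Let c : plane R -> R := 'D_(e_ false) F2.
Let d : plane R -> R := 'D_(e_ true) F2.
Let det : plane R -> R := a * d - b * c.

(** A vector in the kernel of the Jacobian matrix would be a direction along
    which [F] moves points at a speed zero, against the Lipschitz bound on the
    inverse. *)
Lemma jacobian_neq0 x : det x != 0.
Proof.
apply/eqP => det0.
have noker w : a x * w.1 + b x * w.2 = 0 -> c x * w.1 + d x * w.2 = 0 -> w = 0.
  move=> k1 k2; apply/eqP; rewrite -normr_eq0; apply: contraT => w0.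
  have {}w0 : 0 < `|w| by rewrite lt_def w0 /=.
  have dF : is_derive x w F 0.
    apply: is_derive_pair.
      exact: is_derive_eq (derive_direction x w sF1) k1.
    exact: is_derive_eq (derive_direction x w sF2) k2.
  have e0 : 0 < `|w| / 2 / L by rewrite !divr_gt0.
  have /is_deriveP/(_ _ e0)/nbhs_normP[r /= r0 Hr] := dF.
  have /Hr /= : ball_ Num.norm 0 r (r / 2).
    by rewrite /ball_ /= sub0r normrN gtr0_norm ?divr_gt0 //; lra.
  have := GL (F x) (F (r / 2 *: w + x)).
  rewrite !FK addrK scaler0 subr0 normrZ => A B.
  have := le_trans A (ler_wpM2l (ltW L0) B).
  rewrite [X in _ <= X](_ : _ = `|r / 2| * (`|w| / 2)); last first.
    by field; rewrite gt_eqF.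
  by rewrite ler_pM2l ?normr_gt0 ?gt_eqF ?divr_gt0 //; lra.
have D : a x * d x - b x * c x = 0 by [].
have E1 : (b x, - a x) = 0 :> plane R by apply: noker => /=; [ring|lra].
have E2 : (d x, - c x) = 0 :> plane R by apply: noker => /=; [lra|ring].
have b0 : b x = 0 := congr1 fst E1; have d0 : d x = 0 := congr1 fst E2.
have a0 : - a x = 0 := congr1 snd E1; have c0 : - c x = 0 := congr1 snd E2.
have E3 : (1, 0) = 0 :> plane R by apply: noker => /=; lra.
by have /eqP := congr1 fst E3; rewrite oner_eq0.
Qed.

(** The Lipschitz bound on [G] turns the expansion of [F] at [G y] into a linear
    system for the increment of [G], up to a remainder negligible with respect
    to [h]; Cramer's rule solves it. *)
Lemma is_derive_inverse_plane y (v : plane R) :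
  is_derive y v G ((d (G y) * v.1 - b (G y) * v.2) / det (G y),
                   (a (G y) * v.2 - c (G y) * v.1) / det (G y)).
Proof.
have K4 (p q r s : R) : 0 <= p -> 0 <= r -> s + q <= p + q + r + s + 1.
  by lra.
have K4' (p q r s : R) : 0 <= q -> 0 <= s -> r + p <= p + q + r + s + 1.
  by lra.
set x := G y; have dx := jacobian_neq0 x.
set K := `|a x| + `|b x| + `|c x| + `|d x| + 1.
have K0 : 0 < K by rewrite ltr_wpDl // !addr_ge0.
set N := L * `|v| + 1; have N0 : 0 < N by rewrite ltr_wpDl // mulr_ge0 // ltW.
have cG h : `|G (h *: v + y) - x| <= L * `|v| * `|h|.
  by apply: le_trans (GL _ _) _; rewrite addrK normrZ -mulrA [`|v| * _]mulrC.
have Gc : G (h *: v + y) @[h --> (0 : R)] --> x.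
  apply/cvgrPdist_le => e e0; near=> h; rewrite distrC (le_trans (cG h)) //.
  have : `|h| <= e / N by near: h; apply: small_near0; rewrite divr_gt0.
  rewrite ler_pdivlMr // => H; apply: le_trans H; rewrite mulrC ler_wpM2l //.
  by rewrite lerDl.
apply/is_deriveP => e e0.
set e1 := e * `|det x| / K / N.
have e10 : 0 < e1 by rewrite !divr_gt0 // mulr_gt0 // normr_gt0.
have sC (f : plane R -> R) : Ck None f -> forall i, continuous ('D_(e_ i) f).
  by move=> sf i; apply: smooth_continuous; exact: smooth_derive.
have A1 := Gc _ (first_order x (smooth_has_partials sF1) (sC _ sF1) e10).
have A2 := Gc _ (first_order x (smooth_has_partials sF2) (sC _ sF2) e10).
near=> h.
have : `|F1 (G (h *: v + y)) - F1 x - (a x * ((G (h *: v + y)).1 - x.1) +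
     b x * ((G (h *: v + y)).2 - x.2))| <= e1 * `|G (h *: v + y) - x|.
  by near: h; exact: A1.
have : `|F2 (G (h *: v + y)) - F2 x - (c x * ((G (h *: v + y)).1 - x.1) +
     d x * ((G (h *: v + y)).2 - x.2))| <= e1 * `|G (h *: v + y) - x|.
  by near: h; exact: A2.
rewrite /F1 /F2 /= !GK /=.
set D1 := _.1 - x.1; set D2 := _.2 - x.2.
set r2 : R := _ - (c x * D1 + _); set r1 : R := _ - (a x * D1 + _) => B2 B1.
have bnd p q r s : `|p| + `|q| <= K -> `|r| <= e1 * `|G (h *: v + y) - x| ->
    `|s| <= e1 * `|G (h *: v + y) - x| ->
    `|(p * r + q * s) / det x| <= e * `|h|.
  move=> pq Hr Hs; rewrite normrM normfV ler_pdivrMr ?normr_gt0 //.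
  apply: le_trans (ler_normD _ _) _; rewrite !normrM.
  apply: (@le_trans _ _ (K * (e1 * (N * `|h|)))).
    apply: (@le_trans _ _ ((`|p| + `|q|) * (e1 * `|G (h *: v + y) - x|))).
      by rewrite mulrDl lerD // ler_wpM2l.
    apply: ler_pM => //; first by rewrite mulr_ge0 // ltW.
    apply: ler_wpM2l; first exact: ltW.
    by apply: le_trans (cG h) _; rewrite ler_wpM2r // lerDl.
  rewrite /e1 le_eqVlt; apply/orP; left; apply/eqP.
  by field; rewrite !gt_eqF.
have dE : det x = a x * d x - b x * c x by [].
rewrite prod_normE ge_max; apply/andP; split => /=.
- rewrite [X in `|X|](_ : _ = (- d x * r1 + b x * r2) / det x).
    by apply: bnd => //; rewrite normrN; exact: K4.
  rewrite -/D1 /r1 /r2 /GRing.scale /= /GRing.scale /= dE.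
  by field; rewrite -dE.
- rewrite [X in `|X|](_ : _ = (c x * r1 + - a x * r2) / det x).
    by apply: bnd => //; rewrite normrN; exact: K4'.
  rewrite -/D2 /r1 /r2 /GRing.scale /= /GRing.scale /= dE.
  by field; rewrite -dE.
Unshelve. all: by end_near. Qed.

(** The partial derivatives of [G] being smooth functions composed with [G],
    the class of all functions [k \o G] with [k] smooth is stable under partial
    derivatives. *)
Lemma smooth_inverse : Ck None G.
Proof.
have cG : continuous G by exact: lipschitz_continuous GL.
have sdet : Ck None (fun x => (det x)^-1).
  apply: smoothV; last exact: jacobian_neq0.
  by apply: smoothB; apply: smoothM; exact: smooth_derive.
pose A1 i : plane R -> R :=
  ((e_ i).1 *: d - (e_ i).2 *: b) * (fun x => (det x)^-1).
pose A2 i : plane R -> R :=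
  ((e_ i).2 *: a - (e_ i).1 *: c) * (fun x => (det x)^-1).
have sA1 i : Ck None (A1 i).
  apply: smoothM; last exact: sdet.
  by apply: smoothB; apply: smoothZ; exact: smooth_derive.
have sA2 i : Ck None (A2 i).
  apply: smoothM; last exact: sdet.
  by apply: smoothB; apply: smoothZ; exact: smooth_derive.
pose S : set (plane R -> R) := [set f | exists k : plane R -> R, Ck None k /\ f = k \o G].
have SC f : S f -> Ck None f.
  apply: smooth_coind => {}f [k [sk ->]].
  have dk i x : is_derive x (e_ i) (k \o G)
      (('D_(e_ false) k * A1 i + 'D_(e_ true) k * A2 i) (G x)).
    have dG := is_derive_inverse_plane x (e_ i).
    apply: is_derive_eq (chain_rule_plane (smooth_has_partials sk) _
      (is_derive_fst dG) (is_derive_snd dG)) _.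
      by move=> j; apply: smooth_continuous; exact: smooth_derive.
    rewrite [RHS](_ : _ = 'D_(e_ false) k (G x) *
        (((e_ i).1 * d (G x) - (e_ i).2 * b (G x)) / det (G x)) +
      'D_(e_ true) k (G x) *
        (((e_ i).2 * a (G x) - (e_ i).1 * c (G x)) / det (G x))) //=.
    by ring.
  split.
  - move=> x; apply: continuous_comp; first exact: cG.
    exact: smooth_continuous.
  - by move=> i x; case: (dk i x).
  - move=> i; exists ('D_(e_ false) k * A1 i + 'D_(e_ true) k * A2 i); split.
      by apply: smoothD; apply: smoothM;
        [exact: smooth_derive|exact: sA1|exact: smooth_derive|exact: sA2].
    by apply/funext => x; case: (dk i x).
apply: smooth_pair; apply: SC.
- by exists fst; split; first exact: (smooth_fst (@smooth_id R)).
- by exists snd; split; first exact: (smooth_snd (@smooth_id R)).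
Qed.

End SmoothInverse.

Section Perturbation.
Variable R : realType.
Local Notation e_ := (basis_vec R).

Lemma Xc_chart (phi : diffc R) : Xc (chart phi).
Proof.
case: phi => f [g [fK gK sf sg cf]]; split; last exact: cf.
exact: smoothB sf (@smooth_id R).
Qed.

Lemma inverse_lipschitz (f g : vfield R) : cancel f g -> cancel g f ->
  Ck None g -> compact (fsupport (fun x => f x - x)) ->
  exists2 L, 0 < L & forall x y, `|g y - g x| <= L * `|y - x|.
Proof.
move=> fK gK sg cf.
have Xg : Xc (fun x => g x - x).
  split; first exact: smoothB sg (@smooth_id R).
  apply: subclosed_compact cf _; first exact: closed_closure.
  apply: fsupport_sub; first exact: closed_closure.
  move=> x /out_fsupport/eqP; rewrite subr_eq0 => /eqP fx.
  by rewrite -{1}fx fK subrr.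
have [L L0 HL] := Xc_lipschitz Xg.
exists (L + 1); first by rewrite addr_gt0.
move=> x y; rewrite mulrDl mul1r.
rewrite [X in `|X|](_ : _ = (g y - y - (g x - x)) + (y - x)).
  by apply: le_trans (ler_normD _ _) _; rewrite lerD2r.
by rewrite opprB addrAC !subrKA.
Qed.

(** Solving [f x + h x = y] amounts to finding a fixed point of
    [x |-> g (y - h x)], with [g] the inverse of [f]; this map is a contraction
    as soon as [h] has a small Lipschitz constant.  Hence the image of the chart
    is open, already for the C^1 topology. *)
Lemma diffc_perturbation (phi : diffc R) : exists2 delta, 0 < delta &
  forall h : vfield R, Xc h -> (forall i x, `|'D_(e_ i) h x| <= delta) ->
    is_diffc (fun x => x + (chart phi x + h x)).
Proof.
case: phi => f [g [fK gK sf sg cf]].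
have [L L0 gL] := inverse_lipschitz fK gK sg cf.
exists (4 * L)^-1; first by rewrite invr_gt0 mulr_gt0.
move=> h Xh hd; rewrite /chart /=.
set F := fun x => _.
have FE x : F x = f x + h x by rewrite /F addrA [x + _]addrC subrK.
have hL x y : `|h y - h x| <= (2 * L)^-1 * `|y - x|.
  have [sh _] := Xh.
  apply: le_trans (lipschitz_vfield (smooth_has_partials sh) hd x y) _.
  rewrite le_eqVlt; apply/orP; left; apply/eqP; congr (_ * _).
  by field; rewrite gt_eqF.
have Fsurj y : exists x, F x = y.
  have [|x xE] := @contraction_fixpoint_plane R (fun x => g (y - h x)).
    move=> p q; apply: le_trans (gL _ _) _.
    rewrite [X in `|X|](_ : _ = - (h q - h p)) ?normrN; last first.
      by rewrite !opprB addrC subrKA.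
    rewrite -ler_pdivlMl //; apply: le_trans (hL _ _) _.
    rewrite le_eqVlt; apply/orP; left; apply/eqP; rewrite mulrA; congr (_ * _).
    by field; rewrite gt_eqF.
  by exists x; rewrite FE -[in LHS]xE gK xE subrK.
have FL x y : `|y - x| <= 2 * L * `|F y - F x|.
  have A := gL (f x) (f y); rewrite !fK in A.
  have fE : f y - f x = (F y - F x) - (h y - h x).
    by rewrite !FE opprD addrACA addrK.
  have B := ler_normB (F y - F x) (h y - h x); rewrite -fE in B.
  have C := hL x y.
  have D : L * `|f y - f x| <= L * `|F y - F x| + 2^-1 * `|y - x|.
    apply: (@le_trans _ _ (L * (`|F y - F x| + (2 * L)^-1 * `|y - x|))).
      apply: ler_wpM2l; first exact: ltW.
      by apply: le_trans B _; rewrite lerD2l.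
    rewrite mulrDr lerD2l le_eqVlt; apply/orP; left; apply/eqP.
    by rewrite mulrA; congr (_ * _); field; rewrite gt_eqF.
  by move: A D; lra.
pose G y := projT1 (cid (Fsurj y)).
have GK : cancel G F by move=> y; exact: projT2 (cid (Fsurj y)).
have FK : cancel F G.
  move=> x; apply/eqP; rewrite -subr_eq0 -normr_le0.
  by apply: le_trans (FL _ _) _; rewrite GK subrr normr0 mulr0.
have sF : Ck None F.
  have -> : F = f + h by apply/funext => x; rewrite FE.
  by case: Xh => sh _; exact: smoothD sf sh.
exists G; split; [exact: FK|exact: GK|exact: sF| |].
- apply: (smooth_inverse (L := 2 * L) sF FK GK); first by rewrite mulr_gt0.
  by move=> y z; apply: le_trans (FL _ _) _; rewrite !GK.
- have [_] : Xc ((fun x => f x - x) + h).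
    apply: Ck_compactD Xh; split; last exact: cf.
    exact: smoothB sf (@smooth_id R).
  congr (compact (fsupport _)); apply/funext => x.
  by rewrite /F [RHS]addrC addKr.
Qed.

End Perturbation.

(** * Seminorms and differentiable curves of fields *)

Section Seminorms.
Variable R : realType.
Local Notation e_ := (basis_vec R).
Implicit Types (f g W : vfield R) (p : vfield R -> R).
Local Notation cont_seminorm := (continuous_seminorm (C0 None)).

Lemma partials0 s : partials s (0 : vfield R) = 0.
Proof. by elim: s => //= i s ->; apply/funext => x; exact: derive_cst. Qed.

Lemma partialsZ s a f : Ck None f -> partials s (a *: f) = a *: partials s f.
Proof.
move=> sf; have s0 : Ck None (0 : vfield R) := smooth_cst 0.
by have := partials_lin s a sf s0; rewrite partials0 !addr0.
Qed.

Lemma seminormZ p a f : cont_seminorm p -> Xc f -> p (a *: f) = `|a| * p f.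
Proof. by case=> -[_ H] _ Xf; exact: H. Qed.

Lemma seminormD p f g : cont_seminorm p -> Xc f -> Xc g ->
  p (f + g) <= p f + p g.
Proof. by case=> -[H _] _ Xf Xg; exact: H. Qed.

Lemma seminorm0 p : cont_seminorm p -> p 0 = 0.
Proof.
move=> cp; rewrite -[X in p X](scale0r (0 : vfield R)).
by rewrite (seminormZ _ cp) ?normr0 ?mul0r //; exact: Ck_compact0.
Qed.

Lemma seminorm_ge0 p f : cont_seminorm p -> Xc f -> 0 <= p f.
Proof.
move=> cp Xf; have := seminormD cp Xf (Ck_compactZ (-1) Xf).
rewrite (seminormZ _ cp Xf) normrN1 mul1r scaleN1r subrr (seminorm0 cp).
by lra.
Qed.

Lemma supE (A : set R) (b : R) : A !=set0 -> ubound A b ->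
  sup A <= b /\ forall x, A x -> x <= sup A.
Proof.
move=> A0 Ab; split; first exact: ge_sup.
by move=> x Ax; apply: sup_upper_bound => //; split=> //; exists b.
Qed.

(** On the fields supported in a given compact set, only the weights of the
    points of that compact set matter, and these are bounded: so the supremum of
    the weighted values is dominated by a uniform norm there, however fast the
    weights grow at infinity. *)
Lemma weighted_seminorm (I : Type) (w : I -> R) (pt : I -> plane R)
    (s : seq bool) :
  (forall i, 0 <= w i) ->
  (forall K, compact K -> exists C, forall i, K (pt i) -> w i <= C) ->
  exists p, cont_seminorm p /\
    forall f, Xc f -> forall i, w i * `|partials s f (pt i)| <= p f.
Proof.
move=> w0 wK.
pose A f : set R := [set r | r = 0 \/ exists i, r = w i * `|partials s f (pt i)|].
have A0 f : A f !=set0 by exists 0; left.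
have Ab K f M : compact K -> Xc f -> fsupport f `<=` K ->
    (forall x, `|partials s f x| <= M) -> forall C, 0 <= C ->
    (forall i, K (pt i) -> w i <= C) -> ubound (A f) (C * M).
  move=> cK Xf fK fM C C0 HC r; have M0 : 0 <= M := le_trans (normr_ge0 _) (fM 0).
  case=> [->|[i ->]]; first by rewrite mulr_ge0.
  have [Kp|Kp] := pselect (K (pt i)); first by rewrite ler_pM // HC.
  rewrite out_fsupport ?normr0 ?mulr0 ?mulr_ge0 //.
  by apply: contra_not Kp => fp; apply: fK; exact: fsupport_partials fp.
have wK' K : compact K -> exists2 C, 0 <= C & forall i, K (pt i) -> w i <= C.
  move=> /wK[C HC]; exists `|C| => // i /HC wC; exact: le_trans wC (ler_norm _).
have Aub f : Xc f -> exists b, ubound (A f) b.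
  move=> Xf; have [M M0 HM] := bounded_partials s Xf.
  have [C C0 HC] := wK' _ Xf.2; exists (C * M).
  by apply: (Ab (fsupport f)) => //; exact: Xf.2.
have supA f : Xc f -> forall x, A f x -> x <= sup (A f).
  by move=> Xf; have [b /(supE (A0 f))[]] := Aub f Xf.
have supge0 f : Xc f -> 0 <= sup (A f) by move=> Xf; apply: supA => //; left.
have supZ a f : Xc f -> sup (A (a *: f)) <= `|a| * sup (A f).
  move=> Xf; apply: ge_sup => // r [->|[i ->]].
    by rewrite mulr_ge0 // supge0.
  rewrite (partialsZ _ _ Xf.1).
  rewrite normrZ mulrCA ler_wpM2l //.
  by apply: supA => //; right; exists i.
exists (fun f => sup (A f)); split; last first.
  by move=> f Xf i; apply: supA => //; right; exists i.
split; first split.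
- move=> f g Xf Xg; apply: ge_sup => // r [->|[i ->]].
    by rewrite addr_ge0 // supge0.
  have -> : partials s (f + g) = partials s f + partials s g.
    by have := partials_lin s 1 (proj1 Xf) (proj1 Xg); rewrite !scale1r.
  apply: (@le_trans _ _ (w i * (`|partials s f (pt i)| + `|partials s g (pt i)|))).
    by rewrite ler_wpM2l // ler_normD.
  by rewrite mulrDr lerD //; apply: supA => //; right; exists i.
- move=> a f Xf; apply/eqP; rewrite eq_le supZ //=.
  have [->|a0] := eqVneq a 0.
    by rewrite normr0 mul0r; apply: supge0; exact: Ck_compactZ.
  rewrite -ler_pdivlMl ?normr_gt0 // -normfV.
  have := supZ a^-1 _ (Ck_compactZ a Xf).
  by rewrite scalerA mulVf // scale1r.
- move=> K cK; have [C C0 HC] := wK' _ cK.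
  exists (size s); split=> //; exists C => W M XW WK HM.
  by apply: ge_sup => //; apply: (Ab K) => // x; exact: HM.
Qed.

(** Finitely many multi-indices are involved, each of them giving a continuous
    seminorm. *)
Lemma near_partials_small (T : Type) (F : set_system T) (u : T -> vfield R)
    (m : nat) (e : R) : Filter F ->
  (forall h, Xc (u h)) ->
  (forall p, cont_seminorm p -> p (u h) @[h --> F] --> (0 : R)) -> 0 < e ->
  \forall h \near F, forall s x, (size s <= m)%N -> `|partials s (u h) x| <= e.
Proof.
move=> FF Xu Hu e0.
have one s : \forall h \near F, forall x, `|partials s (u h) x| <= e.
  have [||p [cp Hp]] := @weighted_seminorm (plane R) (fun=> 1) id s.
  - by [].
  - by move=> K _; exists 1.
  - have /cvgrPdist_le/(_ _ e0) := Hu p cp; apply: filterS => h.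
    rewrite sub0r normrN => ph x.
    have := Hp _ (Xu h) x; rewrite mul1r => /le_trans; apply.
    exact: le_trans (ler_norm _) ph.
have all_s : \forall h \near F, forall i : 'I_m.+1, forall s : i.-tuple bool,
    forall x, `|partials s (u h) x| <= e.
  by apply: filter_forall => i; apply: filter_forall => s; exact: one.
apply: filterS all_s => h H s x sm.
exact: (H (Ordinal (sm : (size s < m.+1)%N)) (in_tuple s)).
Qed.

(** If the supports escaped to infinity, the family would not tend to zero for
    the seminorm that weighs a sequence of escaping points of the supports by
    the inverses of the values taken there. *)
Lemma near_common_support (u : R -> vfield R) :
  (forall h, Xc (u h)) ->
  (forall p, cont_seminorm p -> p (u h) @[h --> 0^'] --> (0 : R)) ->
  exists2 K : set (plane R), compact K &
    \forall h \near (0 : R)^', fsupport (u h) `<=` K.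
Proof.
move=> Xu Hu.
pose B (n : nat) : set (plane R) :=
  (`[- n%:R, n%:R]%classic `*` `[- n%:R, n%:R]%classic).
have BP n x : B n x <-> `|x| <= n%:R.
  rewrite /B /= !in_itv /= prod_normE ge_max -!ler_norml.
  by split=> [[-> ->]|/andP].
have cB n : compact (B n) by apply: compact_setX; exact: segment_compact.
have clB n : closed (B n).
  by apply: compact_closed => //; exact: norm_hausdorff.
apply: contrapT => noK.
have esc n : exists hx : R * plane R,
    [/\ `|hx.1| < n.+1%:R^-1, hx.1 != 0, n%:R < `|hx.2| & u hx.1 hx.2 != 0].
  apply: contrapT => /forallNP noesc; apply: noK; exists (B n) => //.
  rewrite near_withinE; apply/nbhs_normP.
  exists n.+1%:R^-1; first by rewrite /= invr_gt0.
  move=> h; rewrite /ball_ /= sub0r normrN => hn h0.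
  apply: fsupport_sub => // x Bx; apply: contrapT => ux.
  apply: (noesc (h, x)); split=> //=; last exact/eqP.
  by rewrite ltNge; apply/negP => xn; apply: Bx; exact/BP.
have [hx Hhx] := choice esc.
(* The factor [n] makes the seminorm of [u (hx n).1] at least [n]. *)
pose w n := n%:R / `|u (hx n).1 (hx n).2|.
have [||p [cp Hp]] := @weighted_seminorm nat w (fun n => (hx n).2) [::].
- by move=> n; rewrite divr_ge0.
- move=> K /compact_bounded[M [_ HM]]; pose M' := `|M| + 1.
  have {}HM : forall x, K x -> `|x| <= M'.
    by apply: HM; rewrite (le_lt_trans (ler_norm M)) // ltrDl.
  pose N := (Num.truncn M').+1.
  exists (\sum_(i < N) w i) => n Kn.
  have nN : (n < N)%N.
    rewrite -(@ltr_nat R) (lt_trans _ (truncnS_gt _)) //.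
    by have [_ _ H _] := Hhx n; exact: lt_le_trans H (HM _ Kn).
  rewrite (bigD1 (Ordinal nN)) //= lerDl sumr_ge0 // => i _.
  by rewrite divr_ge0.
- have /cvgrPdist_le/(_ 2^-1)/= := Hu p cp.
  rewrite invr_gt0 ltr0n => /(_ isT); rewrite near_withinE.
  move=> /nbhs_normP[d /= d0 Hd].
  pose n := (Num.truncn d^-1).+1; have [h1 h2 _ h3] := Hhx n.
  have /Hd/(_ h2) : ball_ Num.norm 0 d (hx n).1.
    rewrite /ball_ /= sub0r normrN (lt_le_trans h1) //.
    rewrite -[d]invrK lef_pV2 ?posrE ?invr_gt0 //.
    by rewrite (le_trans (ltW (truncnS_gt _))) // ler_nat.
  rewrite sub0r normrN; have := Hp _ (Xu (hx n).1) n.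
  rewrite /w divfK ?normr_eq0 // => H1 H2.
  have := le_trans H1 (le_trans (ler_norm _) H2).
  have : 1 <= n%:R :> R by rewrite ler1n.
  lra.
Qed.

Lemma Xc_derive_quotient (c c' : R -> vfield R) t t' v :
  (forall h, c (t + h) - c t = c' (t' + h) - c' t') ->
  Xc_derive c t v -> Xc_derive c' t' v.
Proof.
move=> E [Xv H]; split=> // p cp; apply: cvg_trans (H p cp).
by apply: near_eq_cvg; near=> h; rewrite E.
Unshelve. all: by end_near. Qed.

Lemma Xc_derive_shift W (c : R -> vfield R) t v : Xc_derive c t v ->
  Xc_derive (fun s => W + c s) t v.
Proof.
by apply: Xc_derive_quotient => h; rewrite opprD addrACA subrr add0r.
Qed.

Lemma Xc_derive_near (c c' : R -> vfield R) t v :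
  (\forall s \near t, c s = c' s) -> Xc_derive c t v -> Xc_derive c' t v.
Proof.
move=> E [Xv H]; split=> // p cp; apply: cvg_trans (H p cp).
have Et := nbhs_singleton E.
apply: near_eq_cvg; rewrite near_withinE.
have {}E : \forall h \near (0 : R), c (t + h) = c' (t + h).
  by move: E; rewrite nbhs0P.
by apply: filterS E => h -> _; rewrite Et.
Qed.

Lemma seminorm_squeeze p (u : R -> vfield R) (b : R -> R) : cont_seminorm p ->
  (forall h, Xc (u h)) -> (\forall h \near (0 : R)^', p (u h) <= b h) ->
  b h @[h --> 0^'] --> (0 : R) -> p (u h) @[h --> 0^'] --> (0 : R).
Proof.
move=> cp Xu ub b0; apply: (@squeeze_cvgr _ _ _ _ (fun=> 0) b) => //; last exact: cvg_cst.
apply: filterS ub => h ->; rewrite andbT; exact: seminorm_ge0.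
Qed.

Lemma cvg_mul_norm0 (C : R) : 0 <= C -> C * `|h| @[h --> (0 : R)^'] --> (0 : R).
Proof.
move=> C0; apply/cvgrPdist_le => e e0; rewrite near_withinE; near=> h => _.
rewrite sub0r normrN normrM normr_id (ger0_norm C0).
have : `|h| <= e / (C + 1).
  by near: h; apply: small_near0; rewrite divr_gt0 // ltr_wpDl.
rewrite ler_pdivlMr ?ltr_wpDl // => H; apply: le_trans H.
by rewrite mulrC ler_wpM2l // lerDl.
Unshelve. all: by end_near. Qed.

Lemma Xc_deriveD (c c' : R -> vfield R) t v v' :
  (forall s, Xc (c s)) -> (forall s, Xc (c' s)) ->
  Xc_derive c t v -> Xc_derive c' t v' ->
  Xc_derive (fun s => c s + c' s) t (v + v').
Proof.
move=> Xc1 Xc2 [Xv H] [Xv' H']; split; first exact: Ck_compactD.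
have Xq (g : R -> vfield R) (w : vfield R) : (forall s, Xc (g s)) -> Xc w ->
    forall h, Xc (h^-1 *: (g (t + h) - g t) - w).
  move=> Xg Xw h; apply: Ck_compactB Xw; apply: Ck_compactZ.
  exact: Ck_compactB (Xg _) (Xg _).
move=> p cp.
apply: (@seminorm_squeeze p _ (fun h => p (h^-1 *: (c (t + h) - c t) - v) +
  p (h^-1 *: (c' (t + h) - c' t) - v'))) => //.
- apply: (Xq (fun s => c s + c' s)); last exact: Ck_compactD.
  by move=> s; exact: Ck_compactD (Xc1 s) (Xc2 s).
- near=> h; rewrite [X in p X](_ : _ = (h^-1 *: (c (t + h) - c t) - v) +
    (h^-1 *: (c' (t + h) - c' t) - v')).
    exact: seminormD cp (Xq _ _ Xc1 Xv h) (Xq _ _ Xc2 Xv' h).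
  by rewrite opprD addrACA scalerDr -addrA opprD addrACA addrA.
- by rewrite -[X in _ --> X]addr0; exact: cvgD (H p cp) (H' p cp).
Unshelve. all: by end_near. Qed.

Lemma Xc_derive_scale (theta : R -> R) t l W : Xc W ->
  is_derive t (1 : R) theta l -> Xc_derive (fun s => theta s *: W) t (l *: W).
Proof.
move=> XW /is_deriveP dt; split; first exact: Ck_compactZ.
move=> p cp; have p0 := seminorm_ge0 cp XW.
apply/cvgrPdist_le => e e0.
have e1 : 0 < e / (p W + 1) by rewrite divr_gt0 // ltr_wpDl.
rewrite near_withinE; apply: filterS (dt _ e1) => h Hh h0.
rewrite sub0r normrN.
rewrite -scalerBl scalerA -scalerBl (seminormZ _ cp XW) ger0_norm ?mulr_ge0 //.
have hn : 0 < `|h| by rewrite normr_gt0.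
have -> : h^-1 * (theta (t + h) - theta t) - l =
    h^-1 * (theta (h *: 1 + t) - theta t - h *: l).
  by rewrite [h%:A]mulr1 [h + t]addrC [RHS]mulrBr mulKf.
rewrite normrM normfV.
apply: (@le_trans _ _ (e / (p W + 1) * p W)).
  by apply: ler_wpM2r => //; rewrite ler_pdivrMl // mulrC.
by rewrite -mulrA ger_pMr // mulrC ler_pdivrMr ?mul1r ?lerDl // ltr_wpDl.
Qed.

Lemma Xc_derive_cst W t : Xc_derive (fun=> W) t 0.
Proof.
split; first exact: Ck_compact0.
move=> p cp; have H : 0 @[h --> (0 : R)^'] --> (0 : R) by exact: cvg_cst.
apply: cvg_trans H; apply: near_eq_cvg; near=> h.
by rewrite subrr scaler0 subr0 (seminorm0 cp).
Unshelve. all: by end_near.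
Qed.

End Seminorms.

(** * A bump function *)

Section Bump.
Variable R : realType.

Lemma near_gt (a x : R) : a < x -> \forall y \near x, a < y.
Proof.
move=> ax; apply/nbhs_normP; exists (x - a); first by rewrite /= subr_gt0.
by move=> y; rewrite /ball_ /= ltr_norml => /andP[]; lra.
Qed.

Lemma near_lt (a x : R) : x < a -> \forall y \near x, y < a.
Proof.
move=> ax; apply/nbhs_normP; exists (a - x); first by rewrite /= subr_gt0.
by move=> y; rewrite /ball_ /= ltr_norml => /andP[]; lra.
Qed.

Lemma is_derive_affine (f : R -> R) (b t : R) :
  (forall h, f (t + h) = f t + b * h) -> is_derive t (1 : R) f b.
Proof.
move=> fE; apply/is_deriveP => e e0; near=> h.
rewrite [h%:A]mulr1 [h + t]addrC fE -[h *: b]/(h * b) mulrC [X in `|X|](_ : _ = 0).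
  by rewrite normr0 mulr_ge0 // ltW.
by ring.
Unshelve. all: by end_near. Qed.

(** [flat 0] is the flat function [exp (- 1 / x)]; its derivatives are linear
    combinations of the functions [flat k]. *)
Definition flat (k : nat) (x : R) : R :=
  if 0 < x then x^-1 ^+ k * expR (- x^-1) else 0.

(** The exponential series bounds [exp (1 / x)] below by a multiple of
    [(1 / x) ^ (k + 2)].  A quadratic bound is what makes the derivative of
    [flat k] at the origin vanish. *)
Lemma flat_le_sqr k x : `|flat k x| <= (k.+2)`!%:R * x ^+ 2.
Proof.
rewrite /flat; case: ifPn => [x0|_]; last by rewrite normr0 mulr_ge0 // sqr_ge0.
have u0 : 0 < x^-1 by rewrite invr_gt0.
rewrite ger0_norm; last by rewrite mulr_ge0 ?expR_ge0 // exprn_ge0 // ltW.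
rewrite expRN ler_pdivrMr ?expR_gt0 //.
have H := expR_ge1Dxn k.+1 (ltW u0).
have {}H : x^-1 ^+ k.+2 / (k.+2)`!%:R <= expR x^-1.
  by apply: le_trans H; rewrite lerDr.
have f0 : 0 < (k.+2)`!%:R :> R by rewrite ltr0n fact_gt0.
apply: (@le_trans _ _ ((k.+2)`!%:R * x ^+ 2 *
    (x^-1 ^+ k.+2 / (k.+2)`!%:R))); last first.
  by rewrite ler_wpM2l // mulr_ge0 ?(ltW f0) // sqr_ge0.
rewrite le_eqVlt; apply/orP; left; apply/eqP.
rewrite -addn2 exprD [x^-1 ^+ 2]exprVn.
by field; rewrite gt_eqF // gt_eqF.
Qed.

Lemma is_derive_flat k x :
  is_derive x (1 : R) (flat k) (- k%:R * flat k.+1 x + flat k.+2 x).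
Proof.
have [x0|x0|<-] := ltgtP 0 x.
- apply: (@near_eq_is_derive _ _ _
    ((fun u => u ^+ k * expR (- u)) \o (fun y : R => y^-1))).
    near=> y; rewrite /flat ifT //; near: y; exact: near_gt.
  have xn0 : x != 0 by rewrite gt_eqF.
  have dV : is_derive x (1 : R) (fun y : R => y^-1) (- x^-1 ^+ 2).
    apply: is_derive_eq (@is_deriveV R id x 1 1 xn0 (is_derive_id _ _)) _.
    by rewrite /GRing.scale /= mulr1 exprVn.
  have dg : is_derive x^-1 (1 : R) (fun u => u ^+ k * expR (- u))
      ((k%:R * x^-1 ^+ k.-1 - x^-1 ^+ k) * expR (- x^-1)).
    have dN : is_derive x^-1 (1 : R) (-%R : R -> R) (-1) by exact: is_deriveNid.
    have dE : is_derive x^-1 (1 : R) (fun u => expR (- u)) (expR (- x^-1) * (- 1)).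
      exact: (@is_derive1_comp _ _ _ _ _ _ (is_derive_expR _) dN).
    have dX : is_derive x^-1 (1 : R) (fun u => u ^+ k) (k%:R * x^-1 ^+ k.-1).
      split; first exact: exprn_derivable.
      by rewrite exp_derive /GRing.scale /= mulr1.
    have dM := is_deriveM dX dE; apply: is_derive_eq dM _.
    by rewrite /GRing.scale /=; ring.
  apply: is_derive_eq (is_derive1_comp dg dV) _.
  rewrite /flat x0; by case: k dg => [|k] _ /=; rewrite !exprS; ring.
- apply: (@near_eq_is_derive _ _ _ (fun=> 0)).
    near=> y; rewrite /flat ltNge ifF //; apply/negbTE; rewrite negbK ltW //.
    by near: y; exact: near_lt.
  rewrite /flat !ltNge (ltW x0) /= mulr0 addr0; exact: is_derive_cst.
- apply/is_deriveP => e e0.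
  rewrite /flat ltxx mulr0 addr0 -/(flat k) -/(flat _ _).
  near=> h; rewrite scaler0 !subr0 [h%:A]mulr1 addr0.
  have := flat_le_sqr k h; rewrite /flat => /le_trans; apply.
  have : `|h| <= e / (k.+2)`!%:R.
    by near: h; apply: small_near0; rewrite divr_gt0 // ltr0n fact_gt0.
  rewrite ler_pdivlMr ?ltr0n ?fact_gt0 // => H.
  rewrite -(ger0_norm (sqr_ge0 h)) normrX expr2 mulrA ler_wpM2r // mulrC.
  exact: H.
Unshelve. all: by end_near. Qed.

(** An algebra of functions stable under derivation that contains the functions
    [hat] and [skew_hat]. *)
Inductive flat_algebra : (R -> R) -> Prop :=
| FA_cst a : flat_algebra (fun=> a)
| FA_id : flat_algebra (fun y => y)
| FA_left k a : flat_algebra (fun y => flat k (y - a))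
| FA_right k a : flat_algebra (fun y => flat k (a - y))
| FA_add f g : flat_algebra f -> flat_algebra g ->
    flat_algebra (fun y => f y + g y)
| FA_mul f g : flat_algebra f -> flat_algebra g ->
    flat_algebra (fun y => f y * g y).

Lemma flat_algebra_derive f : flat_algebra f ->
  (forall t, derivable f t 1) /\ flat_algebra (derive1 f).
Proof.
suff H : flat_algebra f -> exists2 g, flat_algebra g &
    forall t, is_derive t (1 : R) f (g t).
  move=> /H[g Ag fg]; split; first by move=> t; case: (fg t).
  suff -> : (derive1 f) = g by [].
  by apply/funext => t; rewrite derive1E; case: (fg t).
elim=> {f} [a||k a|k a|f g Af [f' Af' df] Ag [g' Ag' dg]
                      |f g Af [f' Af' df] Ag [g' Ag' dg]].
- by exists (fun=> 0); [exact: FA_cst|move=> t; exact: is_derive_cst].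
- by exists (fun=> 1); [exact: FA_cst|move=> t; exact: is_derive_id].
- exists (fun y => - k%:R * flat k.+1 (y - a) + flat k.+2 (y - a)).
    apply: FA_add (FA_left _ _); apply: FA_mul (FA_left _ _); exact: FA_cst.
  move=> t; have dB : is_derive t (1 : R) (fun y => y - a) 1.
    by apply: is_derive_affine => h; ring.
  have H := @is_derive1_comp R (flat k) (fun y => y - a) t _ _
    (is_derive_flat k (t - a)) dB.
  apply: (is_derive_eq H).
  by rewrite mulr1.
- exists (fun y => (-1) * (- k%:R * flat k.+1 (a - y) + flat k.+2 (a - y))).
    apply: FA_mul; first exact: FA_cst.
    apply: FA_add (FA_right _ _); apply: FA_mul (FA_right _ _); exact: FA_cst.
  move=> t; have dB : is_derive t (1 : R) (fun y => a - y) (-1).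
    by apply: is_derive_affine => h; ring.
  have H := @is_derive1_comp R (flat k) (fun y => a - y) t _ _
    (is_derive_flat k (a - t)) dB.
  apply: (is_derive_eq H).
  by rewrite mulrC.
- exists (fun y => f' y + g' y); first exact: FA_add.
  by move=> t; exact: is_deriveD.
- exists (fun y => f y * g' y + g y * f' y).
    by apply: FA_add; exact: FA_mul.
  move=> t; exact: is_deriveM.
Qed.

Lemma flat_algebra_derive1n f : flat_algebra f -> forall k t,
  is_derive t (1 : R) (derive1n k f) (derive1n k.+1 f t).
Proof.
move=> Af k t; have A : flat_algebra (derive1n k f).
  elim: k => [|k IH]; first by rewrite derive1n0.
  by rewrite derive1nS; have [] := flat_algebra_derive IH.
have [d _] := flat_algebra_derive A.
by rewrite derive1nS derive1E; exact: derivableP.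
Qed.

(** The margins left around the support [1/4, 3/4] make all the derivatives
    vanish near the ends of the unit interval. *)
Definition hat (y : R) : R := flat 0 (y - 4^-1) * flat 0 (3 / 4 - y).

(** The odd companion of [hat]: a combination of both takes any two prescribed
    values at two times symmetric with respect to 1/2, inside the support. *)
Definition skew_hat (y : R) : R := (y - 2^-1) * hat y.

Lemma flat_algebra_hat : flat_algebra hat.
Proof. by apply: FA_mul; [exact: FA_left|exact: FA_right]. Qed.

Lemma flat_algebra_skew_hat : flat_algebra skew_hat.
Proof.
apply: FA_mul flat_algebra_hat.
by apply: FA_add (FA_cst _); exact: FA_id.
Qed.

Lemma hat_sym s : hat (2^-1 - s) = hat (2^-1 + s).
Proof. by rewrite /hat mulrC; congr (flat 0 _ * flat 0 _); field. Qed.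

Lemma hat_bound s : `|s| <= 8^-1 -> flat 0 8^-1 ^+ 2 <= hat (2^-1 + s).
Proof.
have flat_mono (x : R) : 8^-1 <= x -> flat 0 8^-1 <= flat 0 x.
  move=> x8; have x0 : 0 < x by apply: lt_le_trans x8; rewrite invr_gt0 ltr0n.
  rewrite /flat x0 invr_gt0 ltr0n /= !expr0 !mul1r ler_expR lerN2.
  by rewrite lef_pV2 // posrE invr_gt0 ltr0n.
have flat_ge0 : 0 <= flat 0 8^-1.
  by rewrite /flat invr_gt0 ltr0n /= expr0 mul1r expR_ge0.
rewrite ler_norml => /andP[s1 s2]; rewrite expr2 /hat.
by apply: ler_pM => //; apply: flat_mono; lra.
Qed.

Lemma flat8_gt0 : 0 < flat 0 8^-1.
Proof. by rewrite /flat invr_gt0 ltr0n /= expr0 mul1r expR_gt0. Qed.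

Lemma hat_out y : y < 4^-1 \/ 3 / 4 < y -> hat y = 0.
Proof.
have flat_neg x : x <= 0 -> flat 0 x = 0 by rewrite /flat ltNge => ->.
rewrite /hat; case=> H.
  by rewrite [flat 0 _]flat_neg ?mul0r //; lra.
by rewrite [X in _ * X]flat_neg ?mulr0 //; lra.
Qed.

Lemma derive1n_out (f : R -> R) : (forall y, y < 4^-1 \/ 3 / 4 < y -> f y = 0) ->
  forall k y, y < 4^-1 \/ 3 / 4 < y -> (derive1n k f) y = 0.
Proof.
move=> f0; elim=> [|k IH] y Hy; first by rewrite derive1n0; exact: f0.
rewrite derive1nS derive1E (@near_eq_derive _ _ _ _ (fun=> 0)) ?derive_cst //.
case: Hy => Hy; near=> z; apply: IH.
- by left; near: z; exact: near_lt.
- by right; near: z; exact: near_gt.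
Unshelve. all: by end_near. Qed.

Lemma derive1n_bounded f : flat_algebra f ->
  (forall y, y < 4^-1 \/ 3 / 4 < y -> f y = 0) ->
  forall k, exists2 M, 0 <= M & forall y, `|(derive1n k f) y| <= M.
Proof.
move=> Af f0 k.
have cf : continuous (derive1n k f).
  move=> t; apply/differentiable_continuous/derivable1_diffP.
  by case: (flat_algebra_derive1n Af k t).
have /compact_bounded[M [_ HM]] : compact ((derive1n k f) @` `[0, 1]).
  apply: continuous_compact; last exact: segment_compact.
  exact: continuous_subspaceT.
exists (`|M| + 1); first by rewrite addr_ge0.
move=> y; have [y01|y01] := boolP (y \in `[0, 1]).
  apply: (HM (`|M| + 1)); last by exists y.
  by rewrite (le_lt_trans (ler_norm M)) // ltrDl.
rewrite derive1n_out ?normr0 ?addr_ge0 //.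
move: y01; rewrite in_itv /= negb_and -!ltNge.
by case/orP => H; [left|right]; lra.
Qed.

End Bump.

(** * A smooth curve through a fast converging sequence of fields *)

Section Glue.
Variable R : realType.
Local Notation e_ := (basis_vec R).

(** The [n]-th term of the glued curve lives in the slot of the times between
    [node n = 1 / (n + 1)] and [1 / n], and more precisely in an interval of
    length [1 / rate n] above [node n], which [local_time n] maps affinely onto
    the unit interval. *)
Definition node (n : nat) : R := n.+1%:R^-1.

Definition rate (n : nat) : R := n.+1%:R ^+ 2.

Lemma node_gt0 n : 0 < node n. Proof. by rewrite invr_gt0. Qed.

Lemma rate_gt0 n : 0 < rate n. Proof. by rewrite exprn_gt0. Qed.

Lemma rate_ge1 n : 1 <= rate n.
Proof. by rewrite exprn_ege1 // ler1n. Qed.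

Lemma rate_ge n : n.+1%:R <= rate n.
Proof. by rewrite /rate expr2 ler_peMr // ler1n. Qed.

Lemma rateV n : (rate n)^-1 = node n ^+ 2.
Proof. by rewrite /rate /node exprVn. Qed.

Definition local_time (n : nat) (t : R) : R := (t - node n) * rate n.

Definition slot (t : R) : nat := Num.truncn t^-1.

Lemma slot_lt t n : 0 < t -> node n < t -> (slot t <= n)%N.
Proof.
move=> t0 nt; rewrite /slot -ltnS truncn_lt_nat ?invr_ge0 ?(ltW t0) //.
by rewrite -[ltRHS]invrK ltf_pV2 // posrE.
Qed.

Lemma node_slot t : 0 < t -> node (slot t) < t.
Proof.
move=> t0; rewrite -[ltRHS]invrK ltf_pV2 ?posrE ?invr_gt0 //.
exact: truncnS_gt.
Qed.

(** The unit interval in the local time of a slot is contained in the slot,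
    because [1 / (n + 1) + 1 / (n + 1) ^ 2 < 1 / n]. *)
Lemma slot_eq n t : 0 < local_time n t < 1 -> slot t = n.
Proof.
rewrite /local_time => /andP[]; rewrite pmulr_lgt0 ?rate_gt0 // subr_gt0 => nt.
rewrite -ltr_pdivlMr ?rate_gt0 // div1r rateV => tn.
have t0 : 0 < t := lt_trans (node_gt0 n) nt.
apply/truncn_def/andP; split; last first.
  by rewrite -[ltRHS]invrK ltf_pV2 // posrE.
have [->|n0] := posnP n; first by rewrite invr_ge0 ltW.
rewrite -[leLHS]invrK lef_pV2 ?posrE ?invr_gt0 ?ltr0n //.
apply: (@le_trans _ _ (node n + node n ^+ 2)); first by rewrite ltW // -ltrBlDl.
rewrite /node -[n.+1%:R]natr1 -(ler_pM2r (_ : 0 < (n%:R + 1) ^+ 2 * n%:R)); last first.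
  by rewrite mulr_gt0 ?ltr0n // exprn_gt0 // ltr_wpDl.
have n0' : n%:R != 0 :> R by rewrite pnatr_eq0 -lt0n.
have n1 : n%:R + 1 != 0 :> R by rewrite gt_eqF // ltr_wpDl.
rewrite [leLHS](_ : _ = n%:R * (n%:R + 2)); last by field; rewrite natr1 pnatr_eq0.
rewrite [leRHS](_ : _ = (n%:R + 1) ^+ 2); last by field.
by rewrite -subr_ge0 [leRHS](_ : _ = 1) //; ring.
Qed.

Lemma skew_hat_out (y : R) : y < 4^-1 \/ 3 / 4 < y -> skew_hat y = 0.
Proof. by move=> /hat_out H; rewrite /skew_hat H mulr0. Qed.

Lemma hat_derive_bound (k : nat) : exists2 C, 0 <= C & forall y,
  `|derive1n k (@hat R) y| + `|derive1n k (@skew_hat R) y| <= C.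
Proof.
have [M1 M10 HM1] := derive1n_bounded (flat_algebra_hat R) (@hat_out R) k.
have [M2 M20 HM2] := derive1n_bounded (flat_algebra_skew_hat R) skew_hat_out k.
by exists (M1 + M2); [exact: addr_ge0|move=> y; exact: lerD].
Qed.

Variables (K : set (plane R)) (A B : nat -> vfield R) (q : nat -> R) (eps : R).
Hypotheses (cK : compact K) (XA : forall n, Xc (A n)) (XB : forall n, Xc (B n)).
Hypotheses (KA : forall n, fsupport (A n) `<=` K)
           (KB : forall n, fsupport (B n) `<=` K).
Hypothesis smallA : forall n s x, (size s <= n.+1)%N -> `|partials s (A n) x| <= q n.
Hypothesis smallB : forall n s x, (size s <= n.+1)%N -> `|partials s (B n) x| <= q n.
Hypothesis qrate : forall n, q n <= (rate n)^-1 ^+ n.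
Hypothesis qeps : forall n, q n <= eps.

(** The [k]-th time derivative of the [n]-th term of the glued curve. *)
Definition glue_term (n k : nat) (t : R) : vfield R :=
  (rate n ^+ k * derive1n k (@hat R) (local_time n t)) *: A n +
  (rate n ^+ k * derive1n k (@skew_hat R) (local_time n t)) *: B n.

Lemma Xc_glue_term n k t : Xc (glue_term n k t).
Proof. exact: Ck_compactD (Ck_compactZ _ (XA n)) (Ck_compactZ _ (XB n)). Qed.

Lemma is_derive_local_time (f : R -> R) n k t : flat_algebra f ->
  is_derive t (1 : R) (fun s => rate n ^+ k * derive1n k f (local_time n s))
    (rate n ^+ k.+1 * derive1n k.+1 f (local_time n t)).
Proof.
move=> Af; have dl : is_derive t (1 : R) (local_time n) (rate n).
  by apply: is_derive_affine => h; rewrite /local_time; ring.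
have H1 := is_derive1_comp (flat_algebra_derive1n Af k (local_time n t)) dl.
have H2 := is_deriveZ (rate n ^+ k) H1.
by apply: (is_derive_eq H2); rewrite /GRing.scale /= exprS; ring.
Qed.

Lemma Xc_derive_glue_term n k t :
  Xc_derive (glue_term n k) t (glue_term n k.+1 t).
Proof.
apply: Xc_deriveD.
- by move=> s; exact: Ck_compactZ (XA n).
- by move=> s; exact: Ck_compactZ (XB n).
- apply: Xc_derive_scale; first exact: XA.
  exact/is_derive_local_time/flat_algebra_hat.
- apply: Xc_derive_scale; first exact: XB.
  exact/is_derive_local_time/flat_algebra_skew_hat.
Qed.

Lemma glue_term_out n k t : slot t != n -> glue_term n k t = 0.
Proof.
move=> tn; have Hy : local_time n t < 4^-1 \/ 3 / 4 < local_time n t.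
  apply: contrapT => /not_orP[/negP + /negP]; rewrite -!leNgt => H1 H2.
  by move/eqP : tn; apply; apply: slot_eq; apply/andP; split; lra.
rewrite /glue_term !derive1n_out ?mulr0 ?scale0r ?addr0 //.
- exact: skew_hat_out.
- exact: hat_out.
Qed.

Lemma fsupport_glue_term n k t : fsupport (glue_term n k t) `<=` K.
Proof.
apply: fsupport_sub; first by apply: compact_closed => //; exact: norm_hausdorff.
move=> x Kx; rewrite /glue_term fctE /= [LHS]/(_ *: A n x + _ *: B n x).
have -> : A n x = 0.
  by apply: out_fsupport; apply: contra_not Kx; exact: KA.
have -> : B n x = 0.
  by apply: out_fsupport; apply: contra_not Kx; exact: KB.
by rewrite !scaler0; exact: addr0.
Qed.

Lemma glue_term_bound (k : nat) (C : R) :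
  (forall y, `|derive1n k (@hat R) y| + `|derive1n k (@skew_hat R) y| <= C) ->
  forall n t s x, (size s <= n.+1)%N ->
    `|partials s (glue_term n k t) x| <= rate n ^+ k * (C * q n).
Proof.
move=> HC n t s x sn.
rewrite /glue_term partials_lin; last 2 first.
- by have [] := XA n.
- by apply: smoothZ; have [] := XB n.
rewrite partialsZ; last by have [] := XB n.
have rk : 0 <= rate n ^+ k by rewrite exprn_ge0 // ltW // rate_gt0.
set u : R := derive1n k (@hat R) _; set w : R := derive1n k (@skew_hat R) _.
have nE (r : R) (v : plane R) :
    `|(rate n ^+ k * r) *: v| = rate n ^+ k * (`|r| * `|v|).
  by rewrite normrZ normrM (ger0_norm rk) mulrA.
apply: le_trans (ler_normD _ _) _.
rewrite [leLHS](_ : _ = rate n ^+ k * (`|u| * `|partials s (A n) x|) +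
  rate n ^+ k * (`|w| * `|partials s (B n) x|)); last by rewrite -!nE.
rewrite -mulrDr ler_wpM2l //.
apply: (@le_trans _ _ ((`|u| + `|w|) * q n)).
  by rewrite mulrDl lerD // ler_wpM2l //; [exact: smallA|exact: smallB].
rewrite ler_wpM2r //; last exact: HC.
exact: le_trans (smallA (n := n) (s := [::]) 0 isT).
Qed.

(** Each derivative with respect to time costs a factor [rate n], but [q n] is
    so small that for [n >= k + 2] it pays for [k] of them and leaves a factor
    [1 / rate n ^ 2]. *)
Lemma glue_term_small (k m : nat) : exists n0, forall n, (n0 <= n)%N ->
  forall t s x, (size s <= m)%N -> `|partials s (glue_term n k t) x| <= (rate n)^-1.
Proof.
have [C C0 /glue_term_bound HC] := hat_derive_bound k.
exists (m + k.+2 + (Num.truncn C).+1)%N => n nn t s x sm.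
have r0 := rate_gt0 n.
apply: le_trans (HC n t s x _) _.
  apply: leq_trans sm _; apply: leq_trans _ (leqnSn _); apply: leq_trans nn.
  by rewrite -addnA leq_addr.
have kn : (k.+2 <= n)%N.
  by apply: leq_trans nn; rewrite addnAC addnC leq_addr.
apply: (@le_trans _ _ (rate n ^+ k * (rate n * (rate n)^-1 ^+ n))).
  rewrite ler_wpM2l // ?exprn_ge0 ?(ltW r0) //; apply: ler_pM => //.
    exact: le_trans (smallA (n := n) (s := [::]) 0 isT).
  apply: le_trans (rate_ge n); apply: (le_trans (ltW (truncnS_gt C))).
  by rewrite ler_nat; apply: leq_trans (leqnSn _); apply: leq_trans nn; rewrite leq_addl.
have -> : (rate n)^-1 ^+ n = (rate n)^-1 ^+ (n - k.+2) * (rate n)^-1 ^+ k.+2.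
  by rewrite -exprD subnK.
rewrite !exprS; set z := (rate n)^-1 ^+ (n - k.+2).
have z1 : z <= 1 by rewrite exprn_ile1 ?invr_ge0 ?invf_le1 ?(ltW r0) ?rate_ge1.
have -> : rate n ^+ k * (rate n * (z * ((rate n)^-1 * ((rate n)^-1 * (rate n)^-1 ^+ k))))
   = (rate n)^-1 * z.
  rewrite exprVn; field; rewrite gt_eqF // expf_neq0 ?gt_eqF //.
by rewrite ger_pMr ?invr_gt0.
Qed.

Definition glued (k : nat) (t : R) : vfield R :=
  if 0 < t then glue_term (slot t) k t else 0.

Lemma Xc_glued k t : Xc (glued k t).
Proof.
by rewrite /glued; case: ifP => _; [exact: Xc_glue_term|exact: Ck_compact0].
Qed.

Lemma glued_sum N k t : 0 < t -> (slot t < N)%N ->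
  glued k t = \sum_(m < N) glue_term m k t.
Proof.
move=> t0 tN; rewrite /glued t0 (bigD1 (Ordinal tN)) //= big1 ?addr0 // => i.
by move=> ii; apply: glue_term_out; apply: contra ii => /eqP E; apply/eqP/val_inj.
Qed.

Lemma Xc_sum_glue_term N k t : Xc (\sum_(m < N) glue_term m k t).
Proof.
elim: N => [|N IH]; first by rewrite big_ord0; exact: Ck_compact0.
by rewrite big_ord_recr; exact: Ck_compactD IH (Xc_glue_term _ _ _).
Qed.

Lemma Xc_derive_sum N k t :
  Xc_derive (fun s => \sum_(m < N) glue_term m k s) t
    (\sum_(m < N) glue_term m k.+1 t).
Proof.
elim: N => [|N IH].
  rewrite big_ord0; have -> : (fun s => \sum_(m < 0) glue_term m k s) = fun=> 0.
    by apply/funext => s; rewrite big_ord0.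
  exact: Xc_derive_cst.
rewrite big_ord_recr.
have -> : (fun s => \sum_(m < N.+1) glue_term m k s) =
    fun s => \sum_(m < N) glue_term m k s + glue_term N k s.
  by apply/funext => s; rewrite big_ord_recr.
apply: Xc_deriveD IH (Xc_derive_glue_term _ _ _).
- by move=> s; exact: Xc_sum_glue_term.
- by move=> s; exact: Xc_glue_term.
Qed.

(** At a time [h] in the slot [n], all the quantities that the seminorm sees are
    bounded by [1 / rate n], which is less than [h ^ 2] because [node n < h]. *)
Lemma Xc_derive_glued0 k : Xc_derive (glued k) 0 (glued k.+1 0).
Proof.
have g0 j : glued j 0 = 0 by rewrite /glued ltxx.
rewrite g0; split; first exact: Ck_compact0.
move=> p cp; have [_ /(_ _ cK)[m [_ [C HC]]]] := cp.
have [n0 Hn0] := glue_term_small k m.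
apply: (@seminorm_squeeze R p _ (fun h => `|C| * `|h|) cp).
- move=> h; apply: Ck_compactB; last exact: Ck_compact0.
  apply: Ck_compactZ.
  exact: Ck_compactB (Xc_glued _ _) (Xc_glued _ _).
- rewrite near_withinE.
  apply: filterS (near_lt (node_gt0 n0)) => h hn h0.
  rewrite g0 !subr0 add0r (seminormZ _ cp (Xc_glued _ _)).
  rewrite normfV ler_pdivrMl ?normr_gt0 // /glued.
  have [hp|_] := boolP (0 < h); last by rewrite (seminorm0 cp) !mulr_ge0.
  have nh : (n0 <= slot h)%N.
    rewrite /slot truncn_ge_nat ?invr_ge0 ?(ltW hp) //.
    have [->|n0p] := posnP n0; first by rewrite invr_ge0 ltW.
    rewrite -[leLHS]invrK lef_pV2 ?posrE ?invr_gt0 ?ltr0n // (le_trans (ltW hn)) //.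
    by rewrite /node lef_pV2 ?posrE ?ltr0n // ler_nat.
  apply: (@le_trans _ _ (C * (rate (slot h))^-1)).
    apply: HC; [exact: Xc_glue_term|exact: fsupport_glue_term|].
    by move=> s x; exact: Hn0.
  apply: (@le_trans _ _ (`|C| * (rate (slot h))^-1)).
    by rewrite ler_wpM2r ?ler_norm // invr_ge0 ltW // rate_gt0.
  rewrite mulrCA ler_wpM2l // rateV -expr2 (gtr0_norm hp).
  by rewrite lerXn2r ?nnegrE ?(ltW hp) ?(ltW (node_gt0 _)) // ltW // node_slot.
- exact: cvg_mul_norm0.
Qed.

Lemma Xc_derive_glued k t : Xc_derive (glued k) t (glued k.+1 t).
Proof.
have [t0|t0|<-] := ltgtP 0 t; last exact: Xc_derive_glued0.
- rewrite (glued_sum k.+1 t0 (ltnSn _)).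
  apply: Xc_derive_near (Xc_derive_sum _ _ _).
  near=> s; apply/esym/glued_sum; last first.
    apply: slot_lt; last by near: s; apply: near_gt; exact: node_slot.
    by near: s; exact: near_gt.
  by near: s; exact: near_gt.
- have g0 j s : s < 0 -> glued j s = 0 by move=> s0; rewrite /glued ltNge (ltW s0).
  rewrite g0 //; apply: Xc_derive_near (Xc_derive_cst 0 t).
  by near=> s; rewrite g0 //; near: s; exact: near_lt.
Unshelve. all: by end_near. Qed.

Lemma glued_partials (C : R) : 0 <= C ->
  (forall y, `|hat y| + `|skew_hat y| <= C) ->
  forall t i x, `|'D_(e_ i) (glued 0 t) x| <= C * eps.
Proof.
move=> C0 HC t i x.
have e0 : 0 <= eps.
  by apply: le_trans (qeps 0); apply: le_trans (smallA (n := 0) (s := [::]) 0 isT).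
rewrite /glued; case: ifPn => _; last first.
  rewrite -[X in `|X|]/(partials [:: i] (0 : vfield R) x) partials0 normr0.
  by rewrite mulr_ge0.
apply: le_trans (@glue_term_bound 0%N C HC (slot t) t [:: i] x isT) _.
by rewrite mul1r ler_wpM2l.
Qed.

Lemma glued_at n s : `|s| <= 8^-1 ->
  glued 0 (node n + (2^-1 + s) / rate n) =
    hat (2^-1 + s) *: (A n + s *: B n).
Proof.
rewrite ler_norml => /andP[s1 s2].
have r0 := rate_gt0 n.
set t := node n + _.
have lt : local_time n t = 2^-1 + s.
  by rewrite /local_time /t addrAC subrr add0r divfK // gt_eqF.
have tn : slot t = n by apply: slot_eq; rewrite lt; apply/andP; split; lra.
have t0 : 0 < t by rewrite addr_gt0 ?node_gt0 // divr_gt0 //; lra.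
rewrite /glued t0 tn /glue_term lt expr0 !mul1r !derive1n0 /skew_hat.
by rewrite [_ - 2^-1]addrAC subrr add0r scalerDr scalerA [s * _]mulrC.
Qed.

End Glue.

(** * Uniqueness of integral curves *)

Section Flow.
Variable R : realType.

(** The squared distance of two solutions grows at most exponentially. *)
Lemma ode_unique (W : vfield R) (L : R) (x y : R -> plane R) :
  (forall p q, `|W q - W p| <= L * `|q - p|) ->
  (forall t, is_derive t (1 : R) x (W (x t))) ->
  (forall t, is_derive t (1 : R) y (W (y t))) ->
  x 0 = y 0 -> forall t, 0 <= t -> x t = y t.
Proof.
move=> WL dx dy xy0 t t0.
pose d1 s := (x s).1 - (y s).1; pose d2 s := (x s).2 - (y s).2.
pose w1 s := (W (x s)).1 - (W (y s)).1; pose w2 s := (W (x s)).2 - (W (y s)).2.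
have dd1 s : is_derive s (1 : R) d1 (w1 s).
  exact: is_deriveB (is_derive_fst (dx s)) (is_derive_fst (dy s)).
have dd2 s : is_derive s (1 : R) d2 (w2 s).
  exact: is_deriveB (is_derive_snd (dx s)) (is_derive_snd (dy s)).
pose f s := (d1 s * d1 s + d2 s * d2 s) * expR (- (4 * L) * s).
have dE s : is_derive s (1 : R) (fun s => expR (- (4 * L) * s))
    (expR (- (4 * L) * s) * - (4 * L)).
  have dl : is_derive s (1 : R) (fun s => - (4 * L) * s) (- (4 * L)).
    by apply: is_derive_affine => h; ring.
  exact: (@is_derive1_comp R expR (fun s => - (4 * L) * s) s _ _
    (is_derive_expR _) dl).
have df s : is_derive s (1 : R) f ((2 * (d1 s * w1 s + d2 s * w2 s)
    - 4 * L * (d1 s * d1 s + d2 s * d2 s)) * expR (- (4 * L) * s)).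
  have H := is_deriveM (is_deriveD (is_deriveM (dd1 s) (dd1 s))
    (is_deriveM (dd2 s) (dd2 s))) (dE s).
  apply: (is_derive_eq H); transitivity
    ((d1 s * d1 s + d2 s * d2 s) * (expR (- (4 * L) * s) * - (4 * L)) +
     expR (- (4 * L) * s) * (d1 s * w1 s + d1 s * w1 s +
       (d2 s * w2 s + d2 s * w2 s))); first by [].
  by ring.
have df_le0 s : (2 * (d1 s * w1 s + d2 s * w2 s)
    - 4 * L * (d1 s * d1 s + d2 s * d2 s)) * expR (- (4 * L) * s) <= 0.
  rewrite pmulr_lle0 ?expR_gt0 // subr_le0.
  set m := `|x s - y s|.
  have m1 : `|d1 s| <= m by exact: (norm_fst (x s - y s)).
  have m2 : `|d2 s| <= m by exact: (norm_snd (x s - y s)).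
  have k1 : `|w1 s| <= L * m.
    exact: le_trans (norm_fst (W (x s) - W (y s))) (WL _ _).
  have k2 : `|w2 s| <= L * m.
    exact: le_trans (norm_snd (W (x s) - W (y s))) (WL _ _).
  have L0 : 0 <= L * m by exact: le_trans k1.
  have b1 : d1 s * w1 s <= m * (L * m).
    apply: (le_trans (ler_norm _)); rewrite normrM; exact: ler_pM.
  have b2 : d2 s * w2 s <= m * (L * m).
    apply: (le_trans (ler_norm _)); rewrite normrM; exact: ler_pM.
  have mm : m * (L * m) <= L * (d1 s * d1 s + d2 s * d2 s).
    have [m0|m0] := eqVneq m 0.
      rewrite m0 mul0r; have -> : d1 s = 0.
        by apply/normr0_eq0/eqP; rewrite eq_le normr_ge0 -m0 m1.
      have -> : d2 s = 0.
        by apply/normr0_eq0/eqP; rewrite eq_le normr_ge0 -m0 m2.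
      by rewrite !mul0r addr0 mulr0.
    have mp : 0 < m by rewrite lt_def m0 normr_ge0.
    have L00 : 0 <= L by rewrite -(pmulr_lge0 _ mp).
    rewrite mulrCA ler_wpM2l //.
    rewrite /m prod_normE /= -/(d1 s) -/(d2 s) maxEle.
    case: ifP => _; rewrite -expr2 real_normK ?num_real // expr2.
      by rewrite lerDr -expr2 sqr_ge0.
    by rewrite lerDl -expr2 sqr_ge0.
  by move: b1 b2 mm; set z := d1 s * d1 s + _; lra.
have fc : {within `[0, t], continuous f}.
  apply: continuous_subspaceT => s.
  by apply/differentiable_continuous/derivable1_diffP; case: (df s).
have [c _] := MVT_segment t0 (fun s _ => df s) fc.
have -> : f 0 = 0 by rewrite /f /d1 /d2 xy0 !subrr !mul0r addr0 mul0r.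
rewrite !subr0 => ft.
have : f t <= 0 by rewrite ft mulr_le0_ge0.
rewrite /f pmulr_lle0 ?expR_gt0 // -!expr2 => z0.
have d10 : d1 t = 0.
  apply/eqP; rewrite -sqrf_eq0; apply/eqP.
  by have := sqr_ge0 (d1 t); have := sqr_ge0 (d2 t); lra.
have d20 : d2 t = 0.
  apply/eqP; rewrite -sqrf_eq0; apply/eqP.
  by have := sqr_ge0 (d1 t); have := sqr_ge0 (d2 t); lra.
move: d10 d20 => /subr0_eq e1 /subr0_eq e2.
by rewrite (surjective_pairing (x t)) e1 e2 -surjective_pairing.
Qed.

End Flow.

(** * Curves with the same velocity *)

Section Comparison.
Variable R : realType.
Local Notation e_ := (basis_vec R).

Lemma diffc_ext (phi psi : diffc R) : (forall x, phi x = psi x) -> phi = psi.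
Proof.
case: phi psi => [f pf] [g pg] /= fg.
have E : f = g by apply/funext.
by move: pf pg; rewrite E => pf pg; rewrite (Prop_irrelevance pf pg).
Qed.

Lemma chart_inj (phi psi : diffc R) : chart phi = chart psi -> phi = psi.
Proof.
move=> E; apply: diffc_ext => x.
have := congr1 (fun f => f x) E; rewrite /chart => /eqP.
by rewrite subr_eq subrK => /eqP.
Qed.

Lemma smooth_along (j : diffc R -> R) (phi : diffc R) : smooth_functional j ->
  exists2 delta, 0 < delta & forall D : nat -> R -> vfield R,
    (forall k t, Xc (D k t)) ->
    (forall k t, Xc_derive (D k) t (D k.+1 t)) ->
    (forall t i x, `|'D_(e_ i) (D 0 t) x| <= delta) ->
    exists c : R -> diffc R,
      (forall t, chart (c t) = chart phi + D 0 t) /\ smooth_R (fun t => j (c t)).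
Proof.
move=> sj; have [delta d0 Hd] := diffc_perturbation phi.
exists delta => // D XD dD Dd.
pose c t := Diffc (Hd (D 0 t) (XD 0 t) (Dd t)).
have cE t : chart (c t) = chart phi + D 0 t.
  by apply/funext => x; rewrite /chart /= [LHS]addrC addKr.
exists c; split=> //; apply: sj.
exists (fun k t => if k is 0%N then chart phi + D 0 t else D k t); split.
- by apply/funext => t; rewrite cE.
- case=> [|k] t; last exact: XD.
  exact: Ck_compactD (Xc_chart phi) (XD _ _).
- by case=> [|k] t; [exact: Xc_derive_shift|exact: dD].
Qed.

(** The mean value theorem near the origin, where the continuous derivative of
    [g] is bounded. *)
Lemma smooth_R_lipschitz (g : R -> R) : smooth_R g ->
  exists2 M, 0 < M & exists2 r, 0 < r &
    forall a b, `|a| + `|b - a| < r -> `|g b - g a| <= M * `|b - a|.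
Proof.
move=> sg; pose g' := derive1n 1 g.
have dg t : is_derive t (1 : R) g (g' t).
  by rewrite /g' derive1n1 derive1E; exact/derivableP/(sg 0%N).
have cg : {for 0, continuous g'}.
  exact/differentiable_continuous/derivable1_diffP/(sg 1%N).
have /cvgrPdist_le/(_ _ ltr01)/nbhs_normP[r /= r0 Hr] := cg.
exists (`|g' 0| + 1); first by rewrite ltr_wpDl.
exists r => // a b ab; have [c [ca ->]] := mean_value a b dg.
rewrite normrM ler_wpM2r //.
have /Hr : ball_ Num.norm 0 r c.
  rewrite /ball_ /= sub0r normrN; apply: le_lt_trans ab.
  rewrite -[c](subrK a) addrC (le_trans (ler_normD _ _)) // lerD2l //.
rewrite distrC => H; rewrite -[g' c](subrK (g' 0)) addrC.
by rewrite (le_trans (ler_normD _ _)) // lerD2l.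
Qed.

Lemma interpolate_end (k s t : R) (P W : vfield R) : k != 0 -> s != 0 ->
  k *: (k^-1 *: (P + (t / 2) *: W) + s *: ((t / (2 * s * k)) *: W)) = P + t *: W.
Proof.
move=> k0 s0; rewrite scalerDr !scalerA mulfV // scale1r -addrA -scalerDl.
by congr (_ + _ *: _); field; rewrite k0.
Qed.

Lemma interpolate_start (k s t : R) (P W : vfield R) : k != 0 -> s != 0 ->
  k *: (k^-1 *: (P + (t / 2) *: W) + (- s) *: ((t / (2 * s * k)) *: W)) = P.
Proof.
move=> k0 s0; rewrite scalerDr !scalerA mulfV // scale1r -addrA -scalerDl.
have -> : t / 2 + k * - s * (t / (2 * s * k)) = 0 by field; rewrite k0.
by rewrite scale0r addr0.
Qed.

Variables (j : diffc R -> R) (phi : diffc R).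
Hypothesis sj : smooth_functional j.

(** If [j] told the two curves apart to first order, there would be times [t_n]
    tending to zero as fast as one likes where the values of [j] differ by more
    than [e * |t_n|].  A smooth curve glued from pieces that go from [sigma t_n]
    to [gamma t_n] within a time [2 * |t_n| / (n + 1)] would exist, and [j] would
    not be Lipschitz along it.  This is where equal velocities matter: the
    displacement divided by that time is of size [(n + 1) * |rho t_n|], with
    [rho t] the difference of the two curves divided by [t], which tends to
    zero. *)
Lemma comparison (gamma sigma : R -> diffc R) (v : vfield R) (e : R) :
  gamma 0 = phi -> sigma 0 = phi ->
  Xc_derive (fun t => chart (gamma t)) 0 v ->
  Xc_derive (fun t => chart (sigma t)) 0 v -> 0 < e ->
  \forall t \near (0 : R)^', `|j (gamma t) - j (sigma t)| <= e * `|t|.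
Proof.
move=> g0 s0 [Xv dg] [_ ds] e0.
pose P h : vfield R := chart (sigma h) - chart phi.
pose rho h : vfield R := h^-1 *: (chart (gamma h) - chart (sigma h)).
have XP h : Xc (P h) by exact: Ck_compactB (Xc_chart _) (Xc_chart _).
have Xrho h : Xc (rho h).
  by apply: Ck_compactZ; exact: Ck_compactB (Xc_chart _) (Xc_chart _).
pose quot (c : R -> diffc R) h : vfield R :=
  h^-1 *: (chart (c (0 + h)) - chart (c 0)) - v.
have Xquot c h : Xc (quot c h).
  apply: Ck_compactB Xv; apply: Ck_compactZ.
  exact: Ck_compactB (Xc_chart _) (Xc_chart _).
have rho0 p : continuous_seminorm (C0 None) p -> p (rho h) @[h --> 0^'] --> (0 : R).
  move=> cp.
  apply: (@seminorm_squeeze R p _ (fun h => p (quot gamma h) + p (quot sigma h)) cp).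
  - exact: Xrho.
  - near=> h; rewrite (_ : rho h = quot gamma h + (-1) *: quot sigma h).
      apply: le_trans (seminormD cp (Xquot _ _) (Ck_compactZ _ (Xquot _ _))) _.
      by rewrite (seminormZ _ cp (Xquot _ _)) normrN1 mul1r.
    rewrite /rho /quot g0 s0 !add0r scaleN1r.
    move: (chart (gamma h)) (chart (sigma h)) (chart phi) => X Y Z.
    rewrite [in RHS]opprB subrKA -scalerBr; congr (_ *: _).
    by rewrite opprB subrKA.
  - by have := cvgD (dg p cp) (ds p cp); rewrite addr0; exact.
have P0 p : continuous_seminorm (C0 None) p -> p (P h) @[h --> 0^'] --> (0 : R).
  move=> cp.
  have pv := seminorm_ge0 cp Xv.
  apply: (@seminorm_squeeze R p _ (fun h => (1 + p v) * `|h|) cp).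
  - exact: XP.
  - have /cvgrPdist_le/(_ _ ltr01) := ds p cp; rewrite !near_withinE.
    apply: filterS => h Hh h0.
    have {}Hh : p (quot sigma h) <= 1.
      by apply: le_trans (Hh h0); rewrite sub0r normrN ler_norm.
    have -> : P h = h *: (quot sigma h + v).
      by rewrite /quot /P s0 add0r subrK scalerA mulfV // scale1r.
    rewrite (seminormZ _ cp (Ck_compactD (Xquot _ _) Xv)) mulrC ler_wpM2r //.
    apply: le_trans (seminormD cp (Xquot _ _) Xv) _.
    by rewrite lerD2r.
  - by apply: cvg_mul_norm0; rewrite addr_ge0.
have [K1 cK1 HK1] := near_common_support XP P0.
have [K2 cK2 HK2] := near_common_support Xrho rho0.
have [delta delta0 Hdelta] := smooth_along phi sj.
have [C C0 HC] := hat_derive_bound R 0.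
set kap := flat (R := R) 0 8^-1 ^+ 2.
have kap0 : 0 < kap by rewrite exprn_gt0 // flat8_gt0.
pose q n : R := Num.min ((rate R n)^-1 ^+ n) (delta / (C + 1)).
have C1 : 0 < C + 1 by rewrite ltr_wpDl.
have q0 n : 0 < q n.
  by rewrite lt_min divr_gt0 // andbT exprn_gt0 // invr_gt0 rate_gt0.
apply: contrapT => bad.
have sel n : exists t : R, [/\ t != 0, `|t| * n.+1%:R <= 8^-1,
    fsupport (P t) `<=` K1 /\ fsupport (rho t) `<=` K2,
    forall s x, (size s <= n.+1)%N ->
      `|partials s (P t) x| <= kap * q n / 2 /\ `|partials s (rho t) x| <= kap * q n
    & e * `|t| < `|j (gamma t) - j (sigma t)| ].
  apply: contrapT => /forallNP nosel; apply: bad.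
  have kq : 0 < kap * q n by rewrite mulr_gt0.
  have kq2 : 0 < kap * q n / 2 by rewrite divr_gt0.
  have S1 := @near_partials_small R _ _ P n.+1 _ _ XP P0 kq2.
  have S2 := @near_partials_small R _ _ rho n.+1 _ _ Xrho rho0 kq.
  have S3 : \forall h \near (0 : R)^', `|h| <= 8^-1 / n.+1%:R /\ h != 0.
    rewrite near_withinE.
    have : \forall h \near (0 : R), `|h| <= 8^-1 / n.+1%:R.
      by apply: small_near0; rewrite divr_gt0 ?invr_gt0 ?ltr0n.
    by apply: filterS => h.
  near=> t; rewrite leNgt; apply/negP => tbad; apply: (nosel t).
  have [t1 t0] : `|t| <= 8^-1 / n.+1%:R /\ t != 0 by near: t; exact: S3.
  split=> //.
  - by rewrite -ler_pdivlMr ?ltr0n.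
  - by split; near: t; [exact: HK1|exact: HK2].
  - move=> s x sn; split.
      by move: s x sn; near: t; exact: S1.
    by move: s x sn; near: t; exact: S2.
have [t_ Ht] := choice sel.
(* The glued curve is at [sigma (t_ n)] and [gamma (t_ n)] at the local times
   [1/2 - s_ n] and [1/2 + s_ n] of the slot [n], hence within a time
   [2 * s_ n / rate n = 2 * |t_ n| / (n + 1)]. *)
pose s_ n : R := `|t_ n| * n.+1%:R.
have spos n : 0 < s_ n.
  by have [tn _ _ _ _] := Ht n; rewrite mulr_gt0 ?normr_gt0.
have sle n : `|s_ n| <= 8^-1.
  by have [_ H _ _ _] := Ht n; rewrite ger0_norm // ltW.
pose k_ n := hat (2^-1 + s_ n).
have kk n : kap <= k_ n by exact: hat_bound.
have kpos n : 0 < k_ n := lt_le_trans kap0 (kk n).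
pose A n := (k_ n)^-1 *: (P (t_ n) + (t_ n / 2) *: rho (t_ n)).
pose B n := (t_ n / (2 * s_ n * k_ n)) *: rho (t_ n).
have XA n : Xc (A n).
  by apply: Ck_compactZ; exact: Ck_compactD (XP _) (Ck_compactZ _ (Xrho _)).
have XB n : Xc (B n) by exact: Ck_compactZ (Xrho _).
have KA n : fsupport (A n) `<=` K1 `|` K2.
  have [_ _ [H1 H2] _ _] := Ht n.
  apply: fsupport_sub; first by apply: compact_closed;
    [exact: norm_hausdorff|exact: compactU].
  move=> x /not_orP[x1 x2].
  rewrite -[LHS]/((k_ n)^-1 *: (P (t_ n) x + (t_ n / 2) *: rho (t_ n) x)).
  rewrite (@out_fsupport _ _ (P (t_ n)) x) ?(@out_fsupport _ _ (rho (t_ n)) x);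
    [by rewrite scaler0 addr0 scaler0|..].
  - by apply: contra_not x2; exact: H2.
  - by apply: contra_not x1; exact: H1.
have KB n : fsupport (B n) `<=` K1 `|` K2.
  have [_ _ [_ H2] _ _] := Ht n.
  apply: fsupport_sub; first by apply: compact_closed;
    [exact: norm_hausdorff|exact: compactU].
  move=> x /not_orP[_ x2].
  rewrite -[LHS]/(_ *: rho (t_ n) x) (@out_fsupport _ _ (rho (t_ n)) x) ?scaler0 //.
  by apply: contra_not x2; exact: H2.
have t1 n : `|t_ n| <= 1.
  have [_ H _ _ _] := Ht n.
  have : `|t_ n| <= `|t_ n| * n.+1%:R by rewrite ler_peMr // ler1n.
  by move: H; lra.
have smallA n s x : (size s <= n.+1)%N -> `|partials s (A n) x| <= q n.
  move=> sn; have [_ _ _ /(_ s x sn)[HP Hr] _] := Ht n.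
  have sP : Ck None (P (t_ n)) by case: (XP (t_ n)).
  have sr : Ck None (rho (t_ n)) by case: (Xrho (t_ n)).
  have -> : partials s (A n) x = (k_ n)^-1 *:
      (partials s (P (t_ n)) x + (t_ n / 2) *: partials s (rho (t_ n)) x).
    rewrite /A partialsZ; last exact: smoothD sP (smoothZ _ sr).
    rewrite [P (t_ n) + _]addrC partials_lin //.
    by rewrite [in LHS]addrC.
  rewrite normrZ normfV (gtr0_norm (kpos n)) ler_pdivrMl //.
  apply: (@le_trans _ _ (kap * q n)); last by rewrite ler_wpM2r // ltW.
  apply: le_trans (ler_normD _ _) _; rewrite normrZ (splitr (kap * q n)) lerD //.
  rewrite normrM normfV [`|2|]ger0_norm // mulrAC ler_wpM2r ?invr_ge0 //.
  by apply: le_trans Hr; rewrite ler_piMl.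
have smallB n s x : (size s <= n.+1)%N -> `|partials s (B n) x| <= q n.
  move=> sn; have [tn _ _ /(_ s x sn)[_ Hr] _] := Ht n.
  have sr : Ck None (rho (t_ n)) by case: (Xrho (t_ n)).
  have -> : partials s (B n) x =
      (t_ n / (2 * s_ n * k_ n)) *: partials s (rho (t_ n)) x.
    by rewrite /B partialsZ.
  have cb : `|t_ n / (2 * s_ n * k_ n)| <= kap^-1.
    have den : 0 < 2 * s_ n * k_ n by exact: mulr_gt0 (mulr_gt0 _ (spos n)) (kpos n).
    rewrite normrM normfV (gtr0_norm den) ler_pdivrMr // ler_pdivlMl //.
    rewrite mulrC; apply: ler_pM => //; first exact: ltW.
    by rewrite /s_ mulrCA ler_peMr // -natrM ler1n muln_gt0.
  rewrite normrZ; apply: (@le_trans _ _ (kap^-1 * (kap * q n))).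
    by apply: ler_pM.
  by rewrite mulKf // gt_eqF.
have qrate n : q n <= (rate R n)^-1 ^+ n by rewrite ge_min lexx.
have qeps n : q n <= delta / (C + 1) by rewrite ge_min lexx orbT.
have [||t i x|c [cE sc]] := Hdelta (glued A B).
- exact: Xc_glued.
- move=> k t.
  exact: (Xc_derive_glued (compactU cK1 cK2) XA XB KA KB smallA smallB qrate).
- apply: le_trans (glued_partials XA XB smallA smallB qeps C0 HC t i x) _.
  by rewrite mulrCA ger_pMr // ler_pdivrMr // mul1r lerDl.
pose tau n (s : R) : R := node R n + (2^-1 + s) / rate R n.
have trho n : t_ n *: rho (t_ n) = chart (gamma (t_ n)) - chart (sigma (t_ n)).
  by have [tn _ _ _ _] := Ht n; rewrite /rho scalerA mulfV // scale1r.
have cplus n : j (c (tau n (s_ n))) = j (gamma (t_ n)).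
  congr j; apply: chart_inj; rewrite cE glued_at // -/(k_ n) /A /B.
  rewrite interpolate_end ?gt_eqF // trho /P.
  move: (chart (gamma _)) (chart (sigma _)) (chart phi) => X Y Z.
  by rewrite [Y - Z + _]addrC subrKA addrC subrK.
have cminus n : j (c (tau n (- s_ n))) = j (sigma (t_ n)).
  congr j; apply: chart_inj; rewrite cE glued_at ?normrN // hat_sym -/(k_ n) /A /B.
  rewrite interpolate_start ?gt_eqF // /P.
  move: (chart (sigma _)) (chart phi) => Y Z.
  by rewrite addrC subrK.
have [M M0 [r r0 HM]] := smooth_R_lipschitz sc.
pose n := ((Num.truncn (3 / r)).+1 + (Num.truncn (2 * M / e)).+1)%N.
have n1 : 3 / r < n.+1%:R.
  apply: lt_le_trans (truncnS_gt _) _; rewrite ler_nat /n.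
  by apply: leq_trans (leqnSn _); exact: leq_addr.
have n2 : 2 * M / e < n.+1%:R.
  apply: lt_le_trans (truncnS_gt _) _; rewrite ler_nat /n.
  by apply: leq_trans (leqnSn _); exact: leq_addl.
have N0 : 0 < n.+1%:R :> R by rewrite ltr0n.
have rn := rate_gt0 R n.
have E : tau n (s_ n) - tau n (- s_ n) = 2 * `|t_ n| / n.+1%:R.
  rewrite /tau /s_ /rate; move: (`|t_ n|) (n.+1%:R) N0 => t N N0'.
  by field; rewrite gt_eqF.
have tn0 : 0 < `|t_ n| by have [tn _ _ _ _] := Ht n; rewrite normr_gt0.
have dpos : 0 <= tau n (s_ n) - tau n (- s_ n).
  by rewrite E !mulr_ge0 // invr_ge0 ltW.
have sn8 : s_ n <= 8^-1 by exact: le_trans (ler_norm _) (sle n).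
have apos : 0 <= tau n (- s_ n).
  rewrite addr_ge0 // ?(ltW (node_gt0 R n)) // divr_ge0 ?(ltW rn) //.
  by move: sn8; lra.
have near0 : tau n (s_ n) < r.
  apply: (@le_lt_trans _ _ (2 / n.+1%:R)); last first.
    rewrite ltr_pdivrMr // -ltr_pdivrMl // mulrC; apply: le_lt_trans n1.
    by rewrite ler_wpM2r ?invr_ge0 ?(ltW r0) // ler_nat.
  rewrite /tau (_ : 2 / n.+1%:R = node R n + node R n); last first.
    by rewrite /node; field; rewrite gt_eqF.
  rewrite lerD2l ler_pdivrMr //.
  rewrite /node /rate expr2 mulKf ?gt_eqF //.
  apply: (@le_trans _ _ 1); first by move: sn8; lra.
  by rewrite ler1n.
have := HM (tau n (- s_ n)) (tau n (s_ n)).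
rewrite (ger0_norm dpos) (ger0_norm apos) [_ + (_ - _)]addrC subrK => /(_ near0).
rewrite cplus cminus E; have [_ _ _ _ H1] := Ht n => H2.
have := lt_le_trans H1 H2.
rewrite [X in _ < X](_ : _ = (2 * M / n.+1%:R) * `|t_ n|); last by ring.
rewrite ltr_pM2r // ltr_pdivlMr // => H3.
by move: n2; rewrite ltr_pdivrMr // mulrC; move: H3; lra.
Unshelve. all: by end_near.
Qed.

End Comparison.

(** * Derivatives of a smooth functional *)

Section Derivative.
Variable R : realType.
Local Notation e_ := (basis_vec R).

(** The [k]-th derivative of [a * sin (t / a)], a function of slope 1 at the
    origin whose values are as small as required. *)
Definition small_sine (a : R) (k : nat) (t : R) : R :=
  a * a^-1 ^+ k * sin (a^-1 * t + k%:R * (pi / 2)).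

Lemma is_derive_small_sine a k t :
  is_derive t (1 : R) (small_sine a k) (small_sine a k.+1 t).
Proof.
have dl : is_derive t (1 : R) (fun t => a^-1 * t + k%:R * (pi / 2)) a^-1.
  by apply: is_derive_affine => h; ring.
have H := @is_derive1_comp R sin (fun t => a^-1 * t + k%:R * (pi / 2)) t _ _
  (is_derive_sin _) dl.
have H2 := is_deriveZ (a * a^-1 ^+ k) H.
apply: (is_derive_eq H2); rewrite /small_sine /GRing.scale /=.
have -> : a^-1 * t + k.+1%:R * (pi / 2) = a^-1 * t + k%:R * (pi / 2) + pi / 2.
  by rewrite -natr1; ring.
by rewrite sinDpihalf exprS; ring.
Qed.

(** The curve [chart phi + a * sin (t / a) * v] has velocity [v].  Whereas the
    line [chart phi + t * v] may leave the image of the chart, it stays there if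
    [a] is small.  It is smooth, so that [j] has a derivative along it, which
    [comparison] transfers to all the curves with the same velocity. *)
Lemma directional_derivative (j : diffc R -> R) (phi : diffc R) (v : vfield R) :
  smooth_functional j -> Xc v ->
  exists l : R, forall gamma : R -> diffc R, gamma 0 = phi ->
    Xc_derive (fun t => chart (gamma t)) 0 v ->
    is_derive 0 (1 : R) (fun t => j (gamma t)) l.
Proof.
move=> sj Xv; have [delta d0 Hd] := smooth_along phi sj.
have [M0 M00 HM0] := bounded_partials [:: false] Xv.
have [M1 M10 HM1] := bounded_partials [:: true] Xv.
pose a := delta / (M0 + M1 + 1).
have Mp : 0 < M0 + M1 + 1 by rewrite ltr_wpDl // addr_ge0.
have a0 : 0 < a by rewrite divr_gt0.
have [k t|k t|t i x|sigma [sE ss]] := Hd (fun k t => small_sine a k t *: v).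
- exact: Ck_compactZ Xv.
- exact: Xc_derive_scale Xv (is_derive_small_sine _ _ _).
- have -> : 'D_(e_ i) (small_sine a 0 t *: v) x =
      small_sine a 0 t *: 'D_(e_ i) v x.
    by rewrite deriveZ //; case: Xv => /smooth_has_partials; exact.
  have vM : `|'D_(e_ i) v x| <= M0 + M1 + 1.
    case: i.
    - by apply: (le_trans (HM1 x)); rewrite addrAC lerDr addr_ge0.
    - by apply: (le_trans (HM0 x)); rewrite -addrA lerDl addr_ge0.
  have sa : `|small_sine a 0 t| <= a.
    rewrite /small_sine expr0 mulr1 normrM (gtr0_norm a0) ger_pMr //.
    by rewrite ler_norml sin_geN1 sin_le1.
  rewrite normrZ; apply: le_trans (ler_pM _ _ sa vM) _ => //.
  by rewrite /a divfK // gt_eqF.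
have s0 : sigma 0 = phi.
  apply: chart_inj; rewrite sE /small_sine mulr0 mul0r addr0 sin0 mulr0.
  by rewrite scale0r addr0.
have ds : Xc_derive (fun t => chart (sigma t)) 0 v.
  have H := Xc_derive_shift (chart phi)
    (Xc_derive_scale Xv (is_derive_small_sine a 0 0)).
  have -> : (fun t => chart (sigma t)) = (fun t => chart phi + small_sine a 0 t *: v).
    by apply/funext => t; rewrite sE.
  move: H; rewrite /small_sine expr1 mulfV ?gt_eqF // mulr0 add0r !mul1r.
  by rewrite sin_pihalf scale1r.
have /derivableP/is_deriveP dj := ss 0%N 0.
exists ('D_1 (fun t => j (sigma t)) 0) => gamma g0 dg.
apply/is_deriveP => e e0; have e2 : 0 < e / 2 by rewrite divr_gt0.
have := comparison sj g0 s0 dg ds e2; rewrite near_withinE => C.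
near=> h.
have H1 : `|j (sigma (h *: 1 + 0)) - j (sigma 0) -
    h *: 'D_1 (fun t => j (sigma t)) 0| <= e / 2 * `|h|.
  by near: h; exact: dj.
have H2 : h != 0 -> `|j (gamma h) - j (sigma h)| <= e / 2 * `|h|.
  by near: h; exact: C.
move: H1; rewrite [h%:A]mulr1 addr0 g0 s0.
have [->|h0] := eqVneq h 0.
  by move=> _; rewrite g0 subrr scale0r subr0 !normr0 mulr0.
move=> H1; rewrite [X in `|X|](_ : _ = (j (gamma h) - j (sigma h)) +
    (j (sigma h) - j phi - h *: 'D_1 (fun t => j (sigma t)) 0)); last first.
  by rewrite addrA addrA subrK.
apply: le_trans (ler_normD _ _) _; rewrite (splitr e) mulrDl.
exact: lerD (H2 h0) H1.
Unshelve. all: by end_near. Qed.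

(** Any solution of the flow equation starting from [phi] is the flow of [W]
    composed with [phi]; it also witnesses that the flow of [W] exists. *)
Lemma flow_shape (phi : diffc R) (W : vfield R) (c : R -> diffc R) :
  Xc W -> c 0 = phi ->
  (forall t x, is_derive t (1 : R) (fun s => c s x) (W (c t x))) ->
  forall t, 0 <= t -> flow W t @` shape_of phi = shape_of (c t).
Proof.
move=> XW c0 dc t t0; have [L L0 WL] := Xc_lipschitz XW.
have isf : is_flow W (flow W).
  have [g [_ gK _ _ _]] := diffc_mapP phi.
  have : is_flow W (fun t x => c t (g x)).
    by move=> x; split; [rewrite c0 gK|move=> s; exact: dc].
  by move=> H; rewrite /flow; exact: (xgetPex _ (ex_intro _ _ H)).
have E x : flow W t (phi x) = c t x.
  have [f0 df] := isf (phi x).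
  apply: (ode_unique WL df (fun s => dc s x)) t0.
  by rewrite f0 c0.
rewrite /shape_of; apply/seteqP; split => y /=.
  by move=> [_ [x ux <-] <-]; exists x => //; rewrite E.
by move=> [x ux <-]; exists (phi x); [exists x|exact: E].
Qed.

End Derivative.

(** The derivative of [j] along [gamma] only depends on the velocity of [gamma],
    so that it can be computed along the flow of [W], where the difference
    quotients of [j] are those that define the Eulerian derivative. *)
Theorem theorem1 (R : realType) (j : diffc R -> R)
  (D : set (set (plane R))) (J : set (plane R) -> R)
  (cls : field_class) (H : set (plane R) -> set (vfield R)) :
  smooth_functional j ->
  (forall u, D u -> lebesgue_measurable u) ->
  (forall phi : diffc R, D (shape_of phi)) ->
  (forall phi : diffc R, j phi = J (shape_of phi)) ->
  (forall phi : diffc R,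
     admissible cls D (shape_of phi) (H (shape_of phi))) ->
  (forall phi : diffc R,
     shape_differentiable cls J (shape_of phi) (H (shape_of phi))) ->
  forall (phi : diffc R) (gamma : R -> diffc R) (W : vfield R),
    tangent_curve phi gamma ->
    Xc W ->
    tangent_ident phi gamma W ->
    derivable (fun t => j (gamma t)) 0 1 /\
    push_forward j gamma = eulerian J (shape_of phi) W.
Proof.
move=> sj _ _ jJ _ _ phi gamma W [g0 _] XW [c [[c0 _] [_ [v [dg dc]]] flowc]].
have [l Hl] := directional_derivative phi sj dg.1.
have [djg jgE] := Hl _ g0 dg; have [djc jcE] := Hl _ c0 dc.
split=> //; rewrite /push_forward derive1E jgE; apply/esym.
apply: cvg_lim => //.
have q0 : h^-1 *: (j (c (h *: 1 + 0)) - j (c 0)) @[h --> 0^'] --> l.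
  by rewrite -jcE; exact: djc.
apply: cvg_trans (cvg_dnbhs_at_right q0).
apply: near_eq_cvg; near=> h; have h0 : 0 < h by [].
rewrite /eulerian_quotient (flow_shape XW c0 flowc (ltW h0)) -!jJ c0.
by rewrite [h%:A]mulr1 addr0 mulrC.
Unshelve. all: by end_near. Qed.
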